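(* Let $G$ be a simple planar graph with $n$ vertices. Then $G$ has at least $2^{n/9}$ $\mathbb{Z}_5$-colorings, i.e., for every orientation of $G$ and every function $\varphi: E(G)\to\mathbb{Z}_5$, the number of vertex colorings $c: V(G)\to\mathbb{Z}_5$ such that $c(w)-c(u)\neq\varphi(uw)$ for each edge $uw\in E(G)$ directed from $u$ towards $w$ is at least $2^{n/9}$.
   Context: Graphs are finite. $\mathbb{Z}_5$ is the cyclic group of order 5. A graph is $\Gamma$-colorable, for an Abelian group $\Gamma$, if for an orientation of its edges and every function $\varphi:E(G)\to\Gamma$ there is a coloring $c:V(G)\to\Gamma$ with $c(w)-c(u)\ne\varphi(uw)$ for each edge $uw$ directed towards $w$; the choice of orientation is immaterial (reversing an edge corresponds to negating $\varphi$ on it). ''At least $N$ $\mathbb{Z}_5$-colorings'' means at least $N$ such colorings $c$ for every $\varphi$. *)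

(* Defs.v *)
From HB Require Import structures.
From mathcomp Require Import all_boot all_order all_algebra.
From mathcomp Require Import all_classical all_reals all_analysis.

Set Implicit Arguments.
Unset Strict Implicit.
Unset Printing Implicit Defensive.

Import Order.TTheory GRing.Theory Num.Theory.
Import numFieldNormedType.Exports.

Local Open Scope classical_set_scope.
Local Open Scope ring_scope.

(* A finite graph is a relation e on a finType; it is simple when e is
   symmetric and irreflexive. *)
Definition simple_graph (V : finType) (e : rel V) : Prop :=
  symmetric e /\ irreflexive e.

Definition edge (V : finType) (u v : V) : {set V} := [set u; v]%SET.

(* Since an injective continuous map from [0, 1] to the plane is a
   homeomorphism onto its image, this is the usual notion of simple arc. *)
Definition simple_arc (R : realType) (x y : R * R) (A : set (R * R)) : Prop :=
  exists f : R -> R * R,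
    [/\ {within `[0%R, 1%R], continuous f},
        {in `[0%R, 1%R] &, injective f},
        f 0 = x, f 1 = y & A = f @` `[0%R, 1%R]].

(* The arc A (edge u v) is indexed by an unordered pair, so the orders u, v
   and v, u describe the same edge.  Values of A elsewhere are irrelevant. *)
Definition plane_embedding (R : realType) (V : finType) (e : rel V)
    (p : V -> R * R) (A : {set V} -> set (R * R)) : Prop :=
  injective p /\
  forall u v, e u v ->
    let inner := A (edge u v) `\` [set p u; p v] in
    [/\ simple_arc (p u) (p v) (A (edge u v)),
        forall w, ~ inner (p w) &
        forall x y, e x y -> edge x y <> edge u v ->
          inner `&` A (edge x y) = set0].

Definition planar (R : realType) (V : finType) (e : rel V) : Prop :=
  exists (p : V -> R * R) (A : {set V} -> set (R * R)), plane_embedding e p A.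

(* o u w means that the edge uw is directed from u towards w. *)
Definition orientation (V : finType) (e o : rel V) : Prop :=
  (forall u w, e u w = o u w || o w u) /\
  (forall u w, ~~ (o u w && o w u)).

(* phi is read only at the edges of the oriented graph o; its other values are
   irrelevant, so it stands for a function on the edge set. *)
Definition group_colorings (Gamma : finZmodType) (V : finType) (o : rel V)
    (phi : {set V} -> Gamma) : {set {ffun V -> Gamma}} :=
  [set c : {ffun V -> Gamma} |
    [forall u, forall w, o u w ==> (c w - c u != phi (edge u w))]]%SET.

(* Main.v *)
(* A product of d linear factors over the field with 5 elements which does not
   vanish identically on the n-dimensional grid is nonzero at N points with
   5 ^ (4 n) <= 5 ^ d * N ^ 4.  Applied to the product over the edges of
   c w - c u - phi (uw), this reduces the count to two facts about planar graphs:
   one Z_5-coloring exists, and there are at most 3 n edges.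

   Both facts use only that G has no K_5 and no K_{3,3} minor.  Following
   Thomassen, remove vertices from the boundary, the boundary being the set of
   neighbours in A of a connected set B disjoint from A, which absorbs the
   removed vertices.  Either a boundary vertex has at most two boundary
   neighbours and can be removed, or A splits along an edge of the boundary:
   otherwise B, seen as an apex, would belong to a K_5 or K_{3,3} minor.

   The minors are excluded by van Kampen's argument.  The arcs are replaced by
   chains of points with steps shorter than a fraction of the distance between
   disjoint arcs, and winding numbers are computed modulo 2 by counting crossings
   of a ray.  For chains a, b without common end the windings of a around the
   ends of b and of b around the ends of a add up to the interleaving parity of
   these ends, and summing over all pairs gives a contradiction. *)

Require Import Defs.
From mathcomp Require Import all_boot all_order all_algebra all_field.
From mathcomp Require Import zify ring lra.

Set Implicit Arguments.
Unset Strict Implicit.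
Unset Printing Implicit Defensive.

(** * Structure of graphs without K_5 and K_{3,3} minors *)

Section Connectivity.
Variables (V : finType) (e : rel V).
Hypothesis e_sym : symmetric e.

Definition induced (U : {set V}) (x y : V) : bool :=
  [&& x \in U, y \in U & e x y].

Definition connected_in (U : {set V}) : bool :=
  [forall x in U, forall y in U, connect (induced U) x y].

Definition touches (X : {set V}) (v : V) : bool := [exists u in X, e u v].

Lemma connected_inP (U : {set V}) :
  reflect {in U &, forall x y, connect (induced U) x y} (connected_in U).
Proof.
apply: (iffP forall_inP) => [H x y xU yU|H x xU].
  by have /forall_inP := H x xU; apply.
by apply/forall_inP => y yU; apply: H.
Qed.

Lemma touchesP (X : {set V}) (v : V) :
  reflect (exists2 u, u \in X & e u v) (touches X v).
Proof. exact: exists_inP. Qed.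

Lemma touches_sub (X Y : {set V}) (v : V) :
  X \subset Y -> touches X v -> touches Y v.
Proof. by move=> /subsetP sXY /touchesP[u uX euv]; apply/touchesP; exists u; rewrite ?sXY. Qed.

Lemma touchesU1 (z v : V) (X : {set V}) : touches (z |: X) v = e z v || touches X v.
Proof.
apply/touchesP/orP => [[u]|[ezv|/touchesP[u uX euv]]].
- by rewrite !inE => /orP[/eqP-> ->|uX euv]; [left|right; apply/touchesP; exists u].
- by exists z; rewrite ?setU11.
- by exists u; rewrite // inE uX orbT.
Qed.

Lemma touches0 (v : V) : touches set0 v = false.
Proof. by apply/touchesP => -[u]; rewrite inE. Qed.

Lemma touches1 (z v : V) : touches [set z] v = e z v.
Proof. by rewrite -[[set z]]setU0 touchesU1 touches0 orbF. Qed.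

Lemma connected_in0 : connected_in set0.
Proof. by apply/connected_inP => x y; rewrite inE. Qed.

Lemma connected_in1 (x : V) : connected_in [set x].
Proof. by apply/connected_inP => y z; rewrite !inE => /eqP-> /eqP->; apply: connect0. Qed.

Lemma induced_sym (U : {set V}) : symmetric (induced U).
Proof. by move=> x y; rewrite /induced e_sym andbCA. Qed.

Lemma connect_induced_sub (U W : {set V}) (x y : V) :
  U \subset W -> connect (induced U) x y -> connect (induced W) x y.
Proof.
move=> /subsetP sUW; apply: connect_sub => u v /= /and3P[uU vU euv].
by apply: connect1; rewrite /induced !sUW.
Qed.

Lemma connected_inU (X Y : {set V}) (x y : V) :
    connected_in X -> connected_in Y -> x \in X -> y \in Y -> (x == y) || e x y ->
  connected_in (X :|: Y).
Proof.
move=> /connected_inP cX /connected_inP cY xX yY xy.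
have cxy: connect (induced (X :|: Y)) x y.
  case/orP: xy => [/eqP->|exy]; first exact: connect0.
  by apply: connect1; rewrite /induced !inE xX yY orbT.
have csym : connect_sym (induced (X :|: Y)).
  by apply: sym_connect_sym; apply: induced_sym.
suff H : forall u, u \in X :|: Y -> connect (induced (X :|: Y)) x u.
  apply/connected_inP => u v uU vU; apply: connect_trans (H v vU).
  by rewrite csym; apply: H.
move=> u; rewrite inE => /orP[uX|uY].
  exact: connect_induced_sub (subsetUl _ _) (cX _ _ xX uX).
exact: connect_trans cxy (connect_induced_sub (subsetUr _ _) (cY _ _ yY uY)).
Qed.

Lemma connected_inU1 (z : V) (X : {set V}) :
  connected_in X -> touches X z -> connected_in (z |: X).
Proof.
move=> cX /touchesP[u uX euz].
by apply: (connected_inU (connected_in1 z) cX (set11 z) uX); rewrite e_sym euz orbT.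
Qed.

Lemma connected_in_path (U : {set V}) (x : V) (p : seq V) :
  path (induced U) x p -> connected_in [set y in x :: p].
Proof.
elim: p x => [|y p IH] x /=.
  by move=> _; rewrite (_ : [set _ in _] = [set x]) ?connected_in1 //;
     apply/setP => v; rewrite !inE.
case/andP => /and3P[_ _ exy] /IH cp.
rewrite (_ : [set _ in _] = [set x] :|: [set v in y :: p]); last first.
  by apply/setP => v; rewrite !inE.
apply: (connected_inU (connected_in1 x) cp (set11 x) (y := y)); rewrite ?exy ?orbT //.
by rewrite !inE eqxx.
Qed.

Lemma path_induced_sub (U : {set V}) (x : V) (p : seq V) :
  path (induced U) x p -> {subset p <= U}.
Proof.
elim: p x => //= y p IH x /andP[/and3P[_ yU _]] /IH pU v.
by rewrite inE => /orP[/eqP->|/pU].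
Qed.

(** [C] is the interior of a simple path from [s] to [t]. It is empty when that path is a single
    edge, hence the bag [s |: C] and the conditional last clause. *)
Lemma linking_set (U : {set V}) (s t : V) :
    connected_in U -> s \in U -> t \in U -> s != t ->
  exists C : {set V},
    [/\ C \subset U :\ s :\ t, connected_in (s |: C), touches (s |: C) t &
        C != set0 -> [/\ connected_in C, touches C s & touches C t]].
Proof.
move=> /connected_inP cU sU tU st.
have /connectP[p0 pp0 lp0] := cU _ _ sU tU.
case/shortenP: pp0 lp0 => p pp up _ lp.
case/lastP: p => [|q t'] in pp up lp *; first by rewrite /= in lp; rewrite lp eqxx in st.
rewrite last_rcons in lp; rewrite -{t'}lp in pp up *.
rewrite rcons_path in pp; case/andP: pp => pq /and3P[lU _ elt].
have sub : forall v, v \in q -> v \in U :\ s :\ t.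
  move=> v vq; rewrite !inE; move: up; rewrite -rcons_cons rcons_uniq inE negb_or.
  rewrite [uniq _]/= => /and3P[/andP[_ tq] sq _].
  rewrite (memPn tq) ?(memPn sq) //=.
  exact: path_induced_sub pq _ vq.
have cE : s |: [set v in q] = [set v in s :: q] by apply/setP => v; rewrite !inE.
exists [set v in q]; split.
- by apply/subsetP => v; rewrite inE; apply: sub.
- by rewrite cE; apply: connected_in_path pq.
- apply/touchesP; exists (last s q) => //.
  by rewrite cE inE mem_last.
- case: q {sub cE up lU} pq elt => [|w q] /=.
    by move=> _ _ /eqP[]; apply/setP => v; rewrite !inE.
  move=> /andP[/and3P[_ _ esw] pq] elt _; split.
  + exact: connected_in_path pq.
  + by apply/touchesP; exists w; rewrite ?inE ?eqxx // e_sym.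
  + by apply/touchesP; exists (last w q); rewrite // inE mem_last.
Qed.

Lemma not_connected_split (U : {set V}) : ~~ connected_in U ->
  exists X : {set V}, [/\ X \subset U, X != set0, U :\: X != set0 &
    forall u v, u \in X -> v \in U :\: X -> ~~ e u v].
Proof.
rewrite /connected_in negb_forall_in => /exists_inP[x xU].
rewrite negb_forall_in => /exists_inP[y yU nxy].
exists [set v in U | connect (induced U) x v]; split.
- by apply/subsetP => v; rewrite inE => /andP[].
- by apply/set0Pn; exists x; rewrite inE xU connect0.
- by apply/set0Pn; exists y; rewrite !inE yU (negPf nxy).
- move=> u v; rewrite !inE => /andP[uU cu] /andP[+ vU]; rewrite vU /=.
  apply: contra => euv; apply: connect_trans cu (connect1 _).
  by rewrite /induced uU vU.
Qed.

(* A minor model on the vertices 0, ..., n - 1; r is only read at i < j. *)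
Definition minor_bags (n : nat) (r : rel nat) (B : nat -> {set V}) : Prop :=
  [/\ forall i, i < n -> connected_in (B i),
      forall i, i < n -> B i != set0,
      forall i j, i < j < n -> [disjoint B i & B j] &
      forall i j, i < j < n -> r i j -> exists2 v, v \in B j & touches (B i) v].

Definition K5_rel (i j : nat) : bool := true.
Definition K33_rel (i j : nat) : bool := (i < 3 <= j).

Definition kuratowski_free : Prop :=
  (forall B, ~ minor_bags 5 K5_rel B) /\ (forall B, ~ minor_bags 6 K33_rel B).

End Connectivity.

(** * Minors that contain the apex bag [B] *)

Section Structure.
Variables (V : finType) (e : rel V).
Hypotheses (e_sym : symmetric e) (e_irr : irreflexive e).
Hypothesis e_free : kuratowski_free e.
Local Notation connected_in := (connected_in e).
Local Notation touches := (touches e).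

(** The bags [B], [C], [z] form one side of a K_{3,3} and [n0], [n1], [n2] the other. *)
Lemma no_K33_apex (A B C : {set V}) (z n0 n1 n2 : V) :
    connected_in B -> [disjoint A & B] -> connected_in C ->
    C \subset A -> uniq [:: z; n0; n1; n2] -> all [in A :\: C] [:: z; n0; n1; n2] ->
    [/\ touches B n0, touches B n1 & touches B n2] ->
    [/\ e z n0, e z n1 & e z n2] ->
    [/\ touches C n0, touches C n1 & touches C n2] ->
  False.
Proof.
move=> cB dAB cC sCA.
rewrite /= !inE !negb_or -!andbA => /and3P[zn0 zn1 /and5P[zn2 n01 n02 n12 _]].
case/and5P=> zC zA n0C n0A /and5P[n1C n1A n2C n2A _].
case=> tB0 tB1 tB2 [e0 e1 e2] [tC0 tC1 tC2].
have nB v : v \in A -> v \notin B by move=> vA; rewrite (disjointFr dAB vA).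
have ex1 X n : touches X n -> exists2 v, v \in [set n] & touches X v.
  by exists n; rewrite ?set11.
have BC : [disjoint B & C] by rewrite disjoint_sym; apply: disjointWl dAB.
case: e_free => _ /(_ (nth set0 [:: B; C; [set z]; [set n0]; [set n1]; [set n2]]))[].
split.
- by case=> [|[|[|[|[|[|i]]]]]]; rewrite //= ?connected_in1.
- have C0 : C != set0 by case/touchesP: tC0 => u uC _; apply/set0Pn; exists u.
  have B0 : B != set0 by case/touchesP: tB0 => u uB _; apply/set0Pn; exists u.
  by case=> [|[|[|[|[|[|i]]]]]] => //= _; apply/set0Pn; eexists; exact: set11.
- by case=> [|[|[|[|[|[|i]]]]]] [|[|[|[|[|[|j]]]]]] => /andP[//= _] // _;
    rewrite // disjoint_sym disjoints1 ?nB // inE eq_sym.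
- by case=> [|[|[|[|[|[|i]]]]]] [|[|[|[|[|[|j]]]]]] => /andP[//= _] // _ //= _;
    apply: ex1; rewrite ?touches1.
Qed.

(** The five bags are [B], [z] and the three neighbours, each enlarged by the link that leads to the
    next one in cyclic order. *)
Lemma no_K5_apex (A B C0 C1 C2 : {set V}) (z n0 n1 n2 : V) :
    connected_in B -> [disjoint A & B] ->
    C0 \subset A -> C1 \subset A -> C2 \subset A ->
    [disjoint C0 & C1] -> [disjoint C0 & C2] -> [disjoint C1 & C2] ->
    uniq [:: z; n0; n1; n2] -> all [in A :\: (C0 :|: C1 :|: C2)] [:: z; n0; n1; n2] ->
    [/\ touches B z, touches B n0, touches B n1 & touches B n2] ->
    [/\ e z n0, e z n1 & e z n2] ->
    [/\ connected_in (n0 |: C0), connected_in (n1 |: C1) & connected_in (n2 |: C2)] ->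
    [/\ touches (n0 |: C0) n1, touches (n1 |: C1) n2 & touches (n2 |: C2) n0] ->
  False.
Proof.
move=> cB dAB s0 s1 s2 d01 d02 d12.
rewrite /= !inE !negb_or -!andbA => /and3P[zn0 zn1 /and5P[zn2 n01 n02 n12 _]].
case/and5P=> z0 z1 z2 zA /and5P[n00 n01' n02' n0A] /and5P[n10 n11 n12' n1A].
case/and5P=> n20 n21 n22 n2A _.
case=> tBz tB0 tB1 tB2 [e0 e1 e2] [c0 c1 c2] [t0 t1 t2].
have dBU (C : {set V}) n : C \subset A -> n \in A -> [disjoint B & n |: C].
  move=> sCA nA; rewrite disjoint_sym; apply: disjointWl dAB.
  by rewrite subUset sub1set nA.
have dd (C C' : {set V}) n n' : [disjoint C & C'] -> n != n' -> n \notin C' ->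
    n' \notin C -> [disjoint n |: C & n' |: C'].
  move=> dCC nn nC nC'; rewrite -!setI_eq0 setIUl !setIUr !setU_eq0 !setI_eq0 in dCC *.
  by rewrite dCC !disjoints1 nC inE nn disjoint_sym disjoints1 nC'.
case: e_free => /(_ (nth set0 [:: B; [set z]; n0 |: C0; n1 |: C1; n2 |: C2]))[].
split.
- by case=> [|[|[|[|[|i]]]]]; rewrite //= ?connected_in1.
- have B0 : B != set0 by case/touchesP: tB0 => u uB _; apply/set0Pn; exists u.
  by case=> [|[|[|[|[|i]]]]] => //= _; apply/set0Pn; eexists; first [exact: set11 | exact: setU11].
- case=> [|[|[|[|[|i]]]]] [|[|[|[|[|j]]]]] => /andP[//= _] // _;
  rewrite ?dBU ?dd // 1?eq_sym //.
  + by rewrite disjoint_sym disjoints1 (disjointFr dAB zA).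
  + by rewrite disjoints1 !inE negb_or zn0.
  + by rewrite disjoints1 !inE negb_or zn1.
  + by rewrite disjoints1 !inE negb_or zn2.
- case=> [|[|[|[|[|i]]]]] [|[|[|[|[|j]]]]] => /andP[//= _] // _ _ /=.
  + by exists z; rewrite ?set11.
  + by exists n0; rewrite ?setU11.
  + by exists n1; rewrite ?setU11.
  + by exists n2; rewrite ?setU11.
  + by exists n0; rewrite ?setU11 ?touches1.
  + by exists n1; rewrite ?setU11 ?touches1.
  + by exists n2; rewrite ?setU11 ?touches1.
  + by exists n1; rewrite ?setU11.
  + case/touchesP: t2 => u u2 eu; exists u => //; apply/touchesP; exists n0.
      by rewrite setU11.
    by rewrite e_sym.
  + by exists n2; rewrite ?setU11.
Qed.

(* If no pair {z, m} separates A, the neighbours m of z are pairwise linked in A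
   avoiding z and the third neighbour.  Two intersecting links yield a K_{3,3}
   minor, three disjoint ones a K_5 minor; B is a bag in both cases. *)
Lemma apex_cut_edge (A B : {set V}) (z : V) (n : seq V) :
    connected_in B -> [disjoint A & B] -> z \in A -> touches B z ->
    uniq n -> 2 < size n ->
    {in n, forall m, [&& m \in A, touches B m & e z m]} ->
  exists2 m, m \in n & ~~ connected_in (A :\ z :\ m).
Proof.
move=> cB dAB zA tBz; case: n => [|n0 [|n1 [|n2 n]]] //= un _ Hn.
have /and3P[n0A tB0 e0] := Hn n0 (mem_head _ _).
have /and3P[n1A tB1 e1] : [&& n1 \in A, touches B n1 & e z n1].
  by apply: Hn; rewrite !inE eqxx orbT.
have /and3P[n2A tB2 e2] : [&& n2 \in A, touches B n2 & e z n2].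
  by apply: Hn; rewrite !inE eqxx !orbT.
have U4 : uniq [:: z; n0; n1; n2].
  move: un; rewrite /= !inE !negb_or -!andbA => /and5P[-> -> _ -> _].
  have ne m : e z m -> z != m by move=> em; apply: contraTneq em => ->; rewrite e_irr.
  by rewrite !ne.
have [c0|] := boolP (connected_in (A :\ z :\ n0)); last first.
  by exists n0; rewrite ?mem_head.
have [c1|] := boolP (connected_in (A :\ z :\ n1)); last first.
  by exists n1; rewrite ?inE ?eqxx ?orbT.
have [c2|] := boolP (connected_in (A :\ z :\ n2)); last first.
  by exists n2; rewrite ?inE ?eqxx ?orbT.
exfalso; have := U4.
rewrite /= !inE !negb_or -!andbA => /and3P[zn0 zn1 /and5P[zn2 n01 n02 n12 _]].
have [||//|C0 [s0 d0 t0 l0]] := linking_set e_sym c2 (s := n0) (t := n1).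
- by rewrite !inE n02 eq_sym zn0.
- by rewrite !inE n12 eq_sym zn1.
have [||//|C1 [s1 d1 t1 l1]] := linking_set e_sym c0 (s := n1) (t := n2).
- by rewrite !inE eq_sym n01 eq_sym zn1.
- by rewrite !inE eq_sym n02 eq_sym zn2.
have [|||C2 [s2 d2 t2 l2]] := linking_set e_sym c1 (s := n2) (t := n0).
- by rewrite !inE eq_sym n12 eq_sym zn2.
- by rewrite !inE n01 eq_sym zn0.
- by rewrite eq_sym.
pose W := A :\: [set z; n0; n1; n2].
have sW (C : {set V}) a b c : C \subset A :\ z :\ a :\ b :\ c ->
    [set z; n0; n1; n2] \subset [set z; a; b; c] -> C \subset W.
  move=> /subsetP sC /subsetP s4; apply/subsetP => v vC.
  rewrite inE (contra (s4 v)) /=; have := sC v vC; rewrite !inE.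
    by case/and5P.
  by case/and5P=> *; rewrite !negb_or; apply/andP; split=> //; apply/andP; split=> //; apply/andP.
have {}s0 : C0 \subset W.
  by apply: sW s0 _; apply/subsetP => v; rewrite !inE; case: (v == z); case: (v == n0); case: (v == n1); case: (v == n2).
have {}s1 : C1 \subset W.
  by apply: sW s1 _; apply/subsetP => v; rewrite !inE; case: (v == z); case: (v == n0); case: (v == n1); case: (v == n2).
have {}s2 : C2 \subset W.
  by apply: sW s2 _; apply/subsetP => v; rewrite !inE; case: (v == z); case: (v == n0); case: (v == n1); case: (v == n2).
have all4 (C : {set V}) : C \subset W -> all [in A :\: C] [:: z; n0; n1; n2].
  move=> /subsetP sC; apply/allP => v v4; rewrite inE; apply/andP; split.
    by apply/negP => /sC; rewrite !inE; move: v4; rewrite !inE -!orbA => ->.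
  by move: v4; rewrite !inE => /or4P[]/eqP->.
have WA : W \subset A by apply: subsetDl.
have K33 (C D : {set V}) : C \subset W -> D \subset W -> ~~ [disjoint C & D] ->
    connected_in C -> connected_in D ->
    [/\ touches C n0 || touches D n0, touches C n1 || touches D n1 &
        touches C n2 || touches D n2] -> False.
  move=> sC sD; rewrite -setI_eq0 => /set0Pn[w /setIP[wC wD]] cC cD [T0 T1 T2].
  have sCD : C :|: D \subset W by rewrite subUset sC.
  have TU v : touches C v || touches D v -> touches (C :|: D) v.
    by case/orP; apply: touches_sub; rewrite ?subsetUl ?subsetUr.
  apply: (@no_K33_apex A B (C :|: D) z n0 n1 n2) => //; try by split.
  - by apply: (connected_inU e_sym cC cD wC wD); rewrite eqxx.
  - exact: subset_trans sCD WA.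
  - exact: all4.
  - by split; apply: TU.
(* Links that meet are nonempty, so by the last clause of [linking_set] each touches both of its
   ends; together two links touch all three neighbours. *)
have ne0 (C D : {set V}) : ~~ [disjoint C & D] -> C != set0 /\ D != set0.
  rewrite -setI_eq0 => /set0Pn[w /setIP[wC wD]].
  by split; apply/set0Pn; exists w.
have [D01|/[dup]/ne0[/l0[a1 a2 a3] /l1[b1 b2 b3]] N] := boolP [disjoint C0 & C1]; last first.
  by apply: (K33 C0 C1) => //; split; rewrite ?a2 ?a3 ?b2 ?b3 ?orbT.
have [D02|/[dup]/ne0[/l0[a1 a2 a3] /l2[b1 b2 b3]] N] := boolP [disjoint C0 & C2]; last first.
  by apply: (K33 C0 C2) => //; split; rewrite ?a2 ?a3 ?b2 ?b3 ?orbT.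
have [D12|/[dup]/ne0[/l1[a1 a2 a3] /l2[b1 b2 b3]] N] := boolP [disjoint C1 & C2]; last first.
  by apply: (K33 C1 C2) => //; split; rewrite ?a2 ?a3 ?b2 ?b3 ?orbT.
apply: (@no_K5_apex A B C0 C1 C2 z n0 n1 n2) => //;
  try exact: subset_trans WA; try by split.
by apply: all4; rewrite !subUset s0 s1.
Qed.

End Structure.

(** * Splitting a vertex set along an edge *)

Section Cut.
Variables (V : finType) (e : rel V).
Hypotheses (e_sym : symmetric e) (e_irr : irreflexive e).

(** A 2-separation at the edge [zm]: the pieces [A :\: Y] and [A :\: X] cover all edges inside [A]
    and share exactly [z] and [m]. *)
Record edge_cut (A : {set V}) (z m : V) (X Y : {set V}) : Prop := EdgeCut {
  cut_edge : e z m;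
  cut_cover : A = [set z; m] :|: (X :|: Y);
  cut_disjoint : [disjoint X & Y];
  cut_endl : (z \notin X) && (z \notin Y);
  cut_endr : (m \notin X) && (m \notin Y);
  cut_ne : (X != set0) && (Y != set0);
  cut_sep : forall u v, u \in X -> v \in Y -> ~~ e u v }.

Lemma edge_cutC (A : {set V}) (z m : V) (X Y : {set V}) :
  edge_cut A z m X Y -> edge_cut A z m Y X.
Proof.
case=> ezm cA dXY zXY mXY XY0 sXY.
split; rewrite 1?andbC // 1?disjoint_sym 1?[Y :|: X]setUC // => u v uY vX.
by rewrite e_sym; apply: sXY.
Qed.

(** The splitting case of the induction: among three boundary neighbours, [apex_cut_edge] finds one
    that separates [A] together with [z]. *)
Lemma edge_cutP (A B : {set V}) (z : V) :
    kuratowski_free e ->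
    connected_in e B -> [disjoint A & B] -> z \in A -> touches e B z ->
    2 < #|[set v in A | touches e B v && e z v]| ->
  exists m X Y, [/\ m \in A, touches e B m & edge_cut A z m X Y].
Proof.
move=> e_free cB dAB zA tz; set S := [set v in A | _] => S3.
have [||m] := @apex_cut_edge V e e_sym e_irr e_free A B z (enum S) cB dAB zA tz (enum_uniq _).
- by rewrite -cardE.
- by move=> m; rewrite mem_enum inE.
rewrite mem_enum inE => /and3P[mA tm ezm] /not_connected_split[X [sX X0 Y0 sep]].
exists m, X, (A :\ z :\ m :\: X); split=> //.
have zm : z != m by apply: contraTneq ezm => ->; rewrite e_irr.
split=> //.
- apply/setP => v; move: (subsetP sX v); rewrite !inE.
  have [-> _|vz] := eqVneq v z; first by rewrite zA.
  have [-> _|vm] := eqVneq v m; first by rewrite mA.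
  by case: (v \in X) => //= ->.
- by rewrite disjoint_sym -setI_eq0; apply/eqP/setP => v; rewrite !inE; case: (v \in X); rewrite ?andbF.
- rewrite !inE eqxx andbF andbF andbT.
  by apply/negP => /(subsetP sX); rewrite !inE eqxx andbF.
- rewrite !inE eqxx andbF andbT.
  by apply/negP => /(subsetP sX); rewrite !inE eqxx.
- by rewrite X0.
Qed.

Lemma cut_memD (A : {set V}) (z m : V) (X Y : {set V}) (v : V) :
  edge_cut A z m X Y -> v \in A -> v \notin Y -> v \notin X -> (v == z) || (v == m).
Proof.
case=> _ -> _ _ _ _ _ vA /negPf vY /negPf vX.
by move: vA; rewrite !inE vY vX !orbF.
Qed.

Lemma cut_card_lt (A : {set V}) (z m : V) (X Y : {set V}) :
  edge_cut A z m X Y -> #|A :\: Y| < #|A|.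
Proof.
case=> _ -> _ _ _ /andP[_ /set0Pn[w wY]] _.
apply: proper_card; apply/properP; split; first exact: subsetDl.
by exists w; rewrite !inE wY ?orbT.
Qed.

Lemma cut_edge_side (A : {set V}) (z m : V) (X Y : {set V}) (u v : V) :
    edge_cut A z m X Y -> u \in A -> v \in A -> e u v ->
  (u \in A :\: Y) && (v \in A :\: Y) || (u \in A :\: X) && (v \in A :\: X).
Proof.
case=> _ _ dXY _ _ _ sep uA vA euv; rewrite !inE uA vA !andbT.
have nXY w : (w \in X) && (w \in Y) = false.
  by apply/negP => /andP[wX]; rewrite (disjointFr dXY wX).
have sXY w w' : e w w' -> (w \in X) && (w' \in Y) = false.
  by move=> eww; apply/negP => /andP[wX w'Y]; have := sep _ _ wX w'Y; rewrite eww.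
move: (nXY u) (nXY v) (sXY _ _ euv) (sXY v u); rewrite e_sym euv => + + + /(_ isT).
by case: (u \in X); case: (u \in Y); case: (v \in X); case: (v \in Y).
Qed.

End Cut.

(** * List colouring where a colour at one vertex forbids at most one colour at another *)

Section Coloring.
Variables (V : finType) (e : rel V).
Hypotheses (e_sym : symmetric e) (e_irr : irreflexive e).
Hypothesis e_free : kuratowski_free e.
Variables (K : finType) (cf : V -> V -> rel K).
Hypothesis cf_sym : forall u v a b, cf u v a b = cf v u b a.
Hypothesis cf_fun : forall u v a b b', cf u v a b -> cf u v a b' -> b = b'.
Local Notation connected_in := (connected_in e).
Local Notation touches := (touches e).

Definition proper_on (A : {set V}) (c : V -> K) : Prop :=
  {in A &, forall u v, e u v -> ~~ cf u v (c u) (c v)}.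

(* The vertices of A touching the contracted set B play the role of the outer
   cycle in Thomassen's argument; P is the precoloured set, which will be empty,
   a vertex or an edge. *)
Definition lists_large (A B P : {set V}) (L : V -> {set K}) : Prop :=
  {in A, forall v, v \notin P -> (if touches B v then 3 else 5) <= #|L v|}.

Definition extendable (A P : {set V}) (L : V -> {set K}) (c0 : V -> K) : Prop :=
  exists c : V -> K,
    [/\ {in P, c =1 c0}, {in A, forall v, v \notin P -> c v \in L v} & proper_on A c].

(** Thomassen's induction hypothesis: three colours on the boundary, five inside, precoloured
    vertices on the boundary. Quantifying over [B] lets a removed vertex be absorbed there. *)
Definition extension_property (P : {set V}) (n : nat) : Prop :=
  forall (A B : {set V}) (L : V -> {set K}) (c0 : V -> K),
    #|A| <= n -> connected_in B -> [disjoint A & B] ->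
    {in P, forall v, (v \in A) && touches B v} -> proper_on P c0 ->
    lists_large A B P L -> extendable A P L c0.

Definition update (c : V -> K) (z : V) (k : K) (v : V) : K := if v == z then k else c v.

Definition prune (L : V -> {set K}) (z : V) (a : K) (v : V) : {set K} :=
  if e z v then [set b in L v | ~~ cf z v a b] else L v.

(** By [cf_fun] the colour [a] at [z] conflicts with at most one colour of [v]. *)
Lemma prune_card (L : V -> {set K}) (z : V) (a : K) (v : V) : #|L v| <= #|prune L z a v|.+1.
Proof.
rewrite /prune; case: (e z v) => //.
rewrite -(cardsID [set b | ~~ cf z v a b] (L v)) -addn1.
rewrite leq_add //; first by apply: subset_leq_card; apply/subsetP => b; rewrite !inE.
by apply/card_le1_eqP => b b'; rewrite !inE => /andP[/negPn h _] /andP[/negPn h' _]; apply: cf_fun h' h.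
Qed.

Lemma prune_ge (L : V -> {set K}) (z : V) (a : K) (v : V) (k : nat) :
  k < #|L v| -> k <= #|prune L z a v|.
Proof. by move=> kL; rewrite -ltnS (leq_trans kL) // prune_card. Qed.

Lemma prune_sub (L : V -> {set K}) (z : V) (a : K) (v : V) : prune L z a v \subset L v.
Proof. by rewrite /prune; case: (e z v) => //; apply/subsetP => b; rewrite inE => /andP[]. Qed.

Lemma pruneN (L : V -> {set K}) (z : V) (a : K) (v : V) : ~~ e z v -> prune L z a v = L v.
Proof. by rewrite /prune => /negPf->. Qed.

Lemma prune_ok (L : V -> {set K}) (z : V) (a b : K) (v : V) :
  e z v -> b \in prune L z a v -> ~~ cf z v a b.
Proof. by rewrite /prune => ->; rewrite inE => /andP[]. Qed.

Lemma update_proper (A : {set V}) (c : V -> K) (z : V) (k : K) :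
    proper_on (A :\ z) c -> {in A, forall v, e z v -> ~~ cf z v k (c v)} ->
  proper_on A (update c z k).
Proof.
move=> pc pz u v uA vA euv; rewrite /update.
have [uz|uz] := eqVneq u z; have [vz|vz] := eqVneq v z.
- by rewrite uz vz e_irr in euv.
- by rewrite uz in euv *; apply: pz.
- by rewrite vz in euv *; rewrite cf_sym; apply: pz => //; rewrite e_sym.
- by apply: pc; rewrite ?inE ?uz ?vz.
Qed.

Lemma disjoint_transfer (A B : {set V}) (z : V) :
  [disjoint A & B] -> [disjoint A :\ z & z |: B].
Proof.
rewrite -!setI_eq0 => /eqP/setP d; apply/eqP/setP => v; have := d v; rewrite !inE.
by case: (v == z) => //=; case: (v \in B); rewrite ?andbF.
Qed.

Lemma card_transfer (A : {set V}) (z : V) (n : nat) :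
  z \in A -> #|A| <= n.+1 -> #|A :\ z| <= n.
Proof. by move=> zA; rewrite (cardsD1 z) zA. Qed.

(** If [x] has a boundary neighbour [w], colouring [w] yields a precoloured edge; otherwise [x]
    moves into [B]. *)
Lemma extension_one (n : nat) :
    extension_property set0 n.-1 -> (forall x y, e x y -> extension_property [set x; y] n) ->
  forall x, extension_property [set x] n.
Proof.
move=> E0 E2 x A B L c0 An cB dAB PS _ LL.
have /andP[xA tx] := PS x (set11 x).
have [w /and3P[wA tw exw]|noS] := pickP [pred w | [&& w \in A, touches B w & e x w]].
  have xw : x != w by apply: contraTneq exw => ->; rewrite e_irr.
  have /card_gt0P[b bL] : 0 < #|prune L x (c0 x) w|.
    have := LL w wA; rewrite inE eq_sym xw tw => /(_ isT) L3.
    by apply: prune_ge; apply: ltnW.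
  have [|||c [cP cL cp]] := E2 x w exw A B L (update c0 w b) An cB dAB.
  - by move=> v; rewrite !inE => /orP[]/eqP->; apply/andP.
  - move=> u v; rewrite !inE /update => /orP[]/eqP-> /orP[]/eqP->;
      rewrite ?e_irr ?eqxx ?(negPf xw) // => _; last rewrite cf_sym;
      exact: prune_ok bL.
  - by move=> v vA; rewrite !inE negb_or => /andP[vx _]; apply: LL; rewrite ?inE.
  exists c; split=> //.
  - by move=> v; rewrite inE => /eqP->; rewrite cP ?inE ?eqxx // /update (negPf xw).
  - move=> v vA; rewrite inE => vx; have [->|vw] := eqVneq v w.
      rewrite cP ?inE ?eqxx ?orbT // /update eqxx.
      exact: subsetP (prune_sub _ _ _ _) _ bL.
    by apply: cL => //; rewrite !inE negb_or vx.
(* All neighbours of [x] in [A] are interior here: they keep four of five colours when they become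
   boundary vertices, and three suffice. *)
have [||||||c [_ cL cp]] := E0 (A :\ x) (x |: B) (prune L x (c0 x)) c0.
- by apply: card_transfer xA (leq_trans An (leqSpred n)).
- exact: connected_inU1.
- exact: disjoint_transfer.
- by move=> v; rewrite inE.
- by move=> u v; rewrite inE.
- move=> v; rewrite !inE => /andP[vx vA] _; rewrite touchesU1.
  have := LL v vA; rewrite inE => /(_ vx).
  have [exv|nexv] := boolP (e x v); last by rewrite pruneN.
  have := noS v; rewrite /= vA exv andbT /= => ->.
  by move=> L5; apply: prune_ge; apply: ltnW.
exists (update c x (c0 x)); split.
- by move=> v; rewrite inE => /eqP->; rewrite /update eqxx.
- move=> v vA; rewrite inE /update => vx; rewrite (negPf vx).
  by apply: (subsetP (prune_sub L x (c0 x) v)); apply: cL; rewrite ?inE ?vx.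
- apply: update_proper => // v vA exv; apply: (prune_ok (L := L)) => //.
  by apply: cL; rewrite ?inE ?vA ?andbT //; apply: contraTneq exv => ->; rewrite e_irr.
Qed.

Lemma extension_none (n : nat) :
    extension_property set0 n.-1 -> (forall x, extension_property [set x] n) ->
  extension_property set0 n.
Proof.
move=> E0 E1 A B L c0 An cB dAB _ _ LL.
have [x /andP[xA tx]|noS] := pickP [pred x | (x \in A) && touches B x].
  have /card_gt0P[b bL] : 0 < #|L x|.
    by have := LL x xA; rewrite inE tx => /(_ isT) /ltnW/ltnW.
  have [|||c [cP cL cp]] := E1 x A B L (update c0 x b) An cB dAB.
  - by move=> v; rewrite !inE => /eqP->; apply/andP.
  - by move=> u v; rewrite !inE => /eqP-> /eqP->; rewrite e_irr.
  - by move=> v vA _; apply: LL; rewrite ?inE.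
  exists c; split=> //; first by move=> v; rewrite inE.
  move=> v vA _; have [->|vx] := eqVneq v x; last by apply: cL; rewrite ?inE.
  by rewrite cP ?inE // /update eqxx.
have {}LL v : v \in A -> 5 <= #|L v|.
  by move=> vA; have := LL v vA; rewrite inE; have /= := noS v; rewrite vA /= => -> /(_ isT).
have [/set0Pn[w wA]|/negbNE/eqP A0] := boolP (A != set0); last first.
  by exists c0; split; move=> v; rewrite ?A0 inE.
have /card_gt0P[b bL] : 0 < #|L w| by apply: leq_trans (LL w wA).
(* Nothing in [A] touches [B], so [B] is abandoned and the neighbours of [w] become the new
   boundary. *)
have [||||||c [_ cL cp]] := E0 (A :\ w) [set w] (prune L w b) c0.
- by apply: card_transfer wA (leq_trans An (leqSpred n)).
- exact: connected_in1.
- by rewrite disjoint_sym disjoints1 !inE eqxx.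
- by move=> v; rewrite inE.
- by move=> u v; rewrite inE.
- move=> v; rewrite !inE => /andP[_ vA] _.
  have L5 := LL v vA; rewrite touches1; case: (boolP (e w v)) => [_|/pruneN->//].
  by apply: prune_ge; apply: ltnW.
exists (update c w b); split; first by move=> v; rewrite inE.
- move=> v vA _; rewrite /update; have [->//|vx] := eqVneq v w.
  by apply: (subsetP (prune_sub L w b v)); apply: cL; rewrite ?inE ?vx.
- apply: update_proper => // v vA exv; apply: (prune_ok (L := L)) => //.
  by apply: cL; rewrite ?inE ?vA ?andbT //; apply: contraTneq exv => ->; rewrite e_irr.
Qed.

(** The piece containing the precoloured edge is coloured first; its colours on [z] and [m] then
    precolour the other piece. *)
Lemma extension_cut (n : nat) (A B : {set V}) (L : V -> {set K}) (c0 : V -> K)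
    (x y z m : V) (X Y : {set V}) :
    (forall x y, e x y -> extension_property [set x; y] n) ->
    #|A| <= n.+1 -> connected_in B -> [disjoint A & B] ->
    {in [set x; y], forall v, (v \in A) && touches B v} -> e x y ->
    proper_on [set x; y] c0 -> lists_large A B [set x; y] L ->
    edge_cut e A z m X Y -> touches B z -> touches B m ->
    x \in A :\: Y -> y \in A :\: Y ->
  extendable A [set x; y] L c0.
Proof.
move=> E2 An cB dAB PS exy pP LL cut tz tm xAY yAY.
have AYn : #|A :\: Y| <= n by rewrite -ltnS; apply: leq_trans An; apply: cut_card_lt cut.
have AXn : #|A :\: X| <= n by rewrite -ltnS; apply: leq_trans An; apply: cut_card_lt (edge_cutC e_sym cut).
have dD (Z : {set V}) : [disjoint A :\: Z & B] by apply: disjointWl dAB; apply: subsetDl.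
have [||c1 [c1P c1L c1p]] := E2 x y exy (A :\: Y) B L c0 AYn cB (dD _) _ pP.
- by move=> v vP; have /andP[_ ->] := PS v vP; move: vP; rewrite !inE andbT => /orP[]/eqP->; move: xAY yAY; rewrite !inE => // /andP[-> ->].
- by move=> v /setDP[vA _]; apply: LL.
have [ezm cA dXY /andP[zX zY] /andP[mX mY] _ sep] := cut.
have zA : z \in A by rewrite cA !inE eqxx.
have mA : m \in A by rewrite cA !inE eqxx orbT.
have [|||c2 [c2P c2L c2p]] := E2 z m ezm (A :\: X) B L c1 AXn cB (dD _).
- by move=> v; rewrite !inE => /orP[]/eqP->; rewrite ?zX ?zA ?mX ?mA ?tz ?tm.
- move=> u v uP vP; apply: c1p; [move: uP|move: vP]; rewrite !inE => /orP[]/eqP->; by rewrite ?zY ?zA ?mY ?mA.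
- move=> v /setDP[vA vX] vzm; apply: LL => //.
  apply: contra vzm => vxy; rewrite !inE.
  apply: (cut_memD cut vA _ vX).
  by move: vxy xAY yAY; rewrite !inE => /orP[]/eqP-> /andP[? _] /andP[? _].
(* [z] and [m], the only vertices common to both pieces, have the same colour in [c1] and [c2]. *)
pose c v := if v \in A :\: Y then c1 v else c2 v.
have cY : {in A :\: Y, c =1 c1} by move=> v vY; rewrite /c vY.
have cX : {in A :\: X, c =1 c2}.
  move=> v /setDP[vA vX]; rewrite /c; case: ifP => // /setDP[_ vY].
  by rewrite c2P // !inE; apply: cut_memD cut vA vY vX.
exists c; split.
- move=> v vP; rewrite cY ?c1P //.
  by move: vP; rewrite !in_set2 => /orP[]/eqP->.
- move=> v vA vP; have [vY|nvY] := boolP (v \in A :\: Y); first by rewrite cY // c1L.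
  have vY : v \in Y by move: nvY; rewrite !inE vA andbT negbK.
  have vX : v \notin X by rewrite (disjointFl dXY vY).
  rewrite cX ?inE ?vX //; apply: c2L; rewrite ?inE ?vX //.
  by rewrite negb_or; apply/andP; split; apply: contraTneq vY => ->.
- move=> u v uA vA euv; have /orP[/andP[uY vY]|/andP[uX vX]] := cut_edge_side e_sym cut uA vA euv.
    by rewrite !cY //; apply: c1p.
  by rewrite !cX //; apply: c2p.
Qed.

(** Thomassen's step next to the end [x] of the precoloured edge. If [x] has no boundary neighbour
    besides [y], it is absorbed by [B]; otherwise such a neighbour [z] gives a cut when it has three
    boundary neighbours, and is absorbed itself when it has at most two. *)
Lemma extension_edge (n : nat) :
    (forall x, extension_property [set x] n) ->
    (forall x y, e x y -> extension_property [set x; y] n) ->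
  forall x y, e x y -> extension_property [set x; y] n.+1.
Proof.
move=> E1 E2 x y exy A B L c0 An cB dAB PS pP LL.
have /andP[xA tx] : (x \in A) && touches B x by apply: PS; rewrite set21.
have /andP[yA ty] : (y \in A) && touches B y by apply: PS; rewrite set22.
have xy : x != y by apply: contraTneq exy => ->; rewrite e_irr.
have [z /and4P[zA tz zy exz]|noS] :=
    pickP [pred z | [&& z \in A, touches B z, z != y & e x z]]; last first.
  have [||||||c [cP cL cp]] := E1 y (A :\ x) (x |: B) (prune L x (c0 x)) c0.
  - exact: card_transfer.
  - exact: connected_inU1.
  - exact: disjoint_transfer.
  - by move=> v; rewrite !inE touchesU1 => /eqP->; rewrite eq_sym xy yA exy.
  - by move=> u v; rewrite !inE => /eqP-> /eqP->; rewrite e_irr.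
  - move=> v; rewrite !inE => /andP[vx vA] vy; rewrite touchesU1.
    have := LL v vA; rewrite !inE negb_or vx vy => /(_ isT).
    have [exv|nexv] := boolP (e x v); last by rewrite pruneN.
    have := noS v; rewrite /= vA exv vy !andbT /= => ->.
    by move=> L5; apply: prune_ge; apply: ltnW.
  exists (update c x (c0 x)); split.
  - move=> v; rewrite !inE /update; have [->//|vx /= /eqP->] := eqVneq v x.
    by rewrite cP ?inE.
  - move=> v vA; rewrite !inE negb_or /update => /andP[vx vy]; rewrite (negPf vx).
    by apply: (subsetP (prune_sub L x (c0 x) v)); apply: cL; rewrite ?inE ?vx.
  - apply: update_proper => // v vA exv.
    have [->|vy] := eqVneq v y; first by rewrite cP ?inE // pP ?inE ?eqxx ?orbT.
    apply: (prune_ok (L := L)) => //.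
    by apply: cL; rewrite ?inE ?vA ?andbT //; apply: contraTneq exv => ->; rewrite e_irr.
have xz : x != z by apply: contraTneq exz => ->; rewrite e_irr.
pose S := [set v in A | touches B v && e z v].
have xS : x \in S by rewrite inE xA tx e_sym.
have [S2|S3] := leqP #|S| 2; last first.
  have [m [X [Y [mA tm cut]]]] := edge_cutP e_sym e_irr e_free cB dAB zA tz S3.
  have /orP[/andP[xY yY]|/andP[xX yX]] := cut_edge_side e_sym cut xA yA exy.
    exact: (extension_cut E2 An cB dAB PS exy pP LL cut).
  exact: (extension_cut E2 An cB dAB PS exy pP LL (edge_cutC e_sym cut)).
have /card_gt1P[a [b [aL bL ab]]] : 1 < #|prune L x (c0 x) z|.
  have := LL z zA; rewrite !inE negb_or eq_sym xz zy tz => /(_ isT) L3.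
  exact: prune_ge.
(* Two colours of z, both compatible with x, are reserved: besides x at most one
   neighbour of z in the boundary can forbid one of them. *)
pose L' v := if touches B v then L v else prune (prune L z a) z b v.
have [||||||c [cP cL cp]] := E2 x y exy (A :\ z) (z |: B) L' c0.
- exact: card_transfer.
- exact: connected_inU1.
- exact: disjoint_transfer.
- by move=> v vP; have /andP[vA tv] := PS v vP; rewrite !inE touchesU1 vA tv orbT !andbT;
    move: vP; rewrite !inE => /orP[]/eqP-> //; rewrite eq_sym.
- exact: pP.
- move=> v /setD1P[vz vA] vP; rewrite touchesU1 /L'; have := LL v vA vP.
  case: (touches B v); first by rewrite orbT.
  rewrite orbF; case: (boolP (e z v)) => [ezv|nezv]; last by rewrite !pruneN.
  by move=> L5; do 2!apply: prune_ge.
have [k kab kS] : exists2 k, k \in [:: a; b] & {in S :\ x, forall v, ~~ cf z v k (c v)}.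
  have [v0 v0S|S0] := pickP [in S :\ x]; last first.
    by exists a; rewrite ?mem_head // => v; rewrite S0.
  have Sx v : v \in S :\ x -> v = v0.
    move: v; suff /card_le1_eqP H : #|S :\ x| <= 1 by move=> v vS; apply: H.
    by rewrite -ltnS; apply: leq_trans S2; rewrite (cardsD1 x S) xS.
  have [h|h] := boolP (cf z v0 a (c v0)).
    exists b; rewrite ?inE ?eqxx ?orbT // => v /Sx->.
    apply: contra ab => h'; apply/eqP.
    by rewrite !(cf_sym z) in h h'; apply: cf_fun h h'.
  by exists a; rewrite ?mem_head // => v /Sx->.
have kL : k \in prune L x (c0 x) z by move: kab; rewrite !inE => /orP[]/eqP->.
exists (update c z k); split.
- move=> v vP; rewrite /update; case: eqP => [vz|_]; last exact: cP.
  by move: vP; rewrite vz !inE (negPf zy) eq_sym (negPf xz).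
- move=> v vA vP; rewrite /update; have [->|vz] := eqVneq v z.
    exact: subsetP (prune_sub _ _ _ _) _ kL.
  have : c v \in L' v by apply: cL => //; rewrite !inE vz.
  rewrite /L'; case: (touches B v) => //.
  by move=> /(subsetP (prune_sub _ _ _ _))/(subsetP (prune_sub _ _ _ _)).
apply: update_proper => // v vA ezv.
have [->|vx] := eqVneq v x.
  by rewrite cP ?set21 // cf_sym; apply: prune_ok kL.
have [tv|tv] := boolP (touches B v); first by apply: kS; rewrite !inE vx vA tv.
have vz : v != z by apply: contraTneq ezv => ->; rewrite e_irr.
have : c v \in L' v.
  apply: cL; rewrite ?inE ?vz //.
  by rewrite (negPf vx); apply: contraNneq tv => ->.
rewrite /L' (negPf tv) => h.
move: kab; rewrite !inE => /orP[]/eqP->; last exact: prune_ok ezv h.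
exact: prune_ok ezv (subsetP (prune_sub _ _ _ _) _ h).
Qed.

Theorem kuratowski_free_colorable : 5 <= #|K| ->
  exists c : V -> K, forall u v, e u v -> ~~ cf u v (c u) (c v).
Proof.
move=> K5.
suff [E0 _] : extension_property set0 #|V| /\
    (forall x y, e x y -> extension_property [set x; y] #|V|).
  have /card_gt0P[k _] : 0 < #|K| by apply: leq_trans K5.
  (* With [B] empty there is no boundary yet, and every list is the full colour set. *)
  have [||||||c [_ _ cp]] := E0 setT set0 (fun=> setT) (fun=> k).
  - exact: max_card.
  - exact: connected_in0.
  - by rewrite disjoint_sym -setI_eq0 set0I.
  - by move=> v; rewrite inE.
  - by move=> v; rewrite inE.
  - by move=> v _ _; rewrite touches0 cardsT.
  by exists c => u v; apply: cp; rewrite inE.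
(* A precoloured edge needs [x] in [A], so this base case is vacuous. *)
have small x y : extension_property [set x; y] 0.
  move=> A B L c0; rewrite leqn0 cards_eq0 => /eqP-> _ _ /(_ x).
  by rewrite set21 inE => /(_ isT).
have small0 : extension_property set0 0.
  move=> A B L c0; rewrite leqn0 cards_eq0 => /eqP-> _ _ _ _ _.
  by exists c0; split; move=> v; rewrite inE.
elim: #|V| => [|n [E0 E2]]; first by split.
(* Order of the induction: the edge case at [n.+1] uses the vertex and edge cases at [n]; the vertex
   case and then the empty case at [n.+1] follow. *)
have E2' : forall x y, e x y -> extension_property [set x; y] n.+1.
  apply: extension_edge => //; apply: extension_one => //.
  move=> A B L c0 An; apply: (E0 A B L c0); apply: leq_trans An (leq_pred n).
split=> //; apply: extension_none => //.
exact: extension_one.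
Qed.

End Coloring.

(** * Bound on the number of edges *)

Section EdgeBound.
Variables (V : finType) (e : rel V).
Hypotheses (e_sym : symmetric e) (e_irr : irreflexive e).

(** Ordered pairs: every edge counts twice. *)
Definition arcs (A : {set V}) : {set V * V} :=
  [set p | [&& p.1 \in A, p.2 \in A & e p.1 p.2]].

Lemma card_arcs (A : {set V}) : #|arcs A| = \sum_(u in A) \sum_(v in A) e u v.
Proof.
rewrite -sum1_card (eq_bigl (fun p => (p.1 \in A) && ((p.2 \in A) && e p.1 p.2))).
  rewrite -(pair_big_dep (mem A) (fun u v => (v \in A) && e u v) (fun _ _ => 1)) /=.
  by apply: eq_bigr => u _; rewrite big_mkcondr; apply: eq_bigr => v _; case: (e u v).
by move=> p; rewrite inE.
Qed.

Lemma card_arcsD1 (A : {set V}) (z : V) : z \in A ->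
  #|arcs A| = #|arcs (A :\ z)| + (#|[set v in A | e z v]|).*2.
Proof.
move=> zA; rewrite !card_arcs (big_setD1 z) //=.
have deg : \sum_(v in A) e z v = #|[set v in A | e z v]|.
  transitivity (\sum_(v | (v \in A) && e z v) 1).
    by rewrite big_mkcondr; apply: eq_bigr => v _; case: (e z v).
  by rewrite -sum1_card; apply: eq_bigl => v; rewrite inE.
have deg' : \sum_(u in A :\ z) e u z = #|[set v in A | e z v]|.
  by rewrite -deg [RHS](big_setD1 z) //= e_irr add0n; apply: eq_bigr => u _; rewrite e_sym.
rewrite deg.
have -> : \sum_(u in A :\ z) \sum_(v in A) e u v =
    \sum_(u in A :\ z) e u z + \sum_(u in A :\ z) \sum_(v in A :\ z) e u v.
  by rewrite -big_split; apply: eq_bigr => u _; rewrite (big_setD1 z).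
by rewrite deg' addnA addnn addnC.
Qed.

Lemma card_arcs_le1 (A : {set V}) : #|A| <= 1 -> #|arcs A| = 0.
Proof.
move=> /card_le1_eqP A1; apply/eqP; rewrite cards_eq0; apply/eqP/setP => -[u v].
rewrite !inE /=; apply/negP => /and3P[uA vA]; rewrite (A1 u v uA vA) e_irr //.
Qed.

(** The pieces overlap in [z] and [m] only. Used with [T] the whole vertex set and with [T] the
    boundary. *)
Lemma card_cut (A : {set V}) (z m : V) (X Y : {set V}) (T : {set V}) :
    edge_cut e A z m X Y -> z \in T -> m \in T ->
  #|A :&: T| + 2 = #|(A :\: Y) :&: T| + #|(A :\: X) :&: T|.
Proof.
move=> cut zT mT; rewrite -cardsUI.
have [ezm cA dXY /andP[zX zY] /andP[mX mY] _ _] := cut.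
have zm : z != m by apply: contraTneq ezm => ->; rewrite e_irr.
have zA : z \in A by rewrite cA !inE eqxx.
have mA : m \in A by rewrite cA !inE eqxx orbT.
congr (#|pred_of_set _| + _).
  apply/setP => v; rewrite !inE; have := disjointFr dXY (x := v).
  by case: (v \in X) => [/(_ isT)->|_]; last case: (v \in Y); case: (v \in A); case: (v \in T).
rewrite (_ : _ :&: _ = [set z; m]) ?cards2 ?zm //.
apply/setP => v; rewrite in_set2; apply/idP/idP => [|/orP[]/eqP->]; try by rewrite !inE ?mX ?mY ?mA ?mT ?zX ?zY ?zA ?zT.
rewrite !inE -!andbA => /and5P[vY vA vT vX _].
exact: cut_memD cut vA vY vX.
Qed.

Lemma card_arcs_cut (A : {set V}) (z m : V) (X Y : {set V}) :
  edge_cut e A z m X Y -> #|arcs A| + 2 <= #|arcs (A :\: Y)| + #|arcs (A :\: X)|.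
Proof.
move=> cut; rewrite -cardsUI.
have [ezm cA dXY /andP[zX zY] /andP[mX mY] _ _] := cut.
have zA : z \in A by rewrite cA !inE eqxx.
have mA : m \in A by rewrite cA !inE eqxx orbT.
have zm : z != m by apply: contraTneq ezm => ->; rewrite e_irr.
apply: leq_add.
  apply: subset_leq_card; apply/subsetP => -[u v]; rewrite !inE /=.
  move=> /and3P[uA vA euv]; rewrite uA vA euv !andbT.
  have := cut_edge_side e_sym cut uA vA euv; by rewrite !inE uA vA !andbT.
have -> : 2 = #|[set (z, m); (m, z)]| by rewrite cards2 xpair_eqE (negPf zm).
apply: subset_leq_card; apply/subsetP => p; rewrite in_set2 => /orP[]/eqP->;
  by rewrite !inE /= zX zY mX mY zA mA ?ezm // e_sym ezm.
Qed.

(** Halved, the bound reads 3a - 3 - b edges for a vertices, b of them on the boundary: the count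
    for a near-triangulation with outer cycle of length b. The induction follows the same cases as
    the colouring. *)
Theorem kuratowski_free_arcs (n : nat) (A B : {set V}) :
    kuratowski_free e -> #|A| <= n -> connected_in e B -> [disjoint A & B] -> 2 <= #|A| ->
  #|arcs A| + (#|A :&: [set v | touches e B v]|).*2 + 6 <= 6 * #|A|.
Proof.
move=> e_free; elim: n A B => [|n IH] A B An cB dAB A2; first by lia.
(* Equality holds for two adjacent boundary vertices: 2 + 4 + 6 = 12. *)
have [A2'|A3] := leqP #|A| 2.
  have /card_gt0P[z zA] : 0 < #|A| by lia.
  rewrite (card_arcsD1 zA) card_arcs_le1; last by have := cardsD1 z A; rewrite zA; lia.
  have : #|[set v in A | e z v]| <= #|A :\ z|.
    apply: subset_leq_card; apply/subsetP => v; rewrite !inE => /andP[-> ezv].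
    by rewrite andbT; apply: contraTneq ezv => ->; rewrite e_irr.
  have := subset_leq_card (subsetIl A [set v | touches e B v]).
  by have := cardsD1 z A; rewrite zA; lia.
set T := [set v | touches e B v].
have [S0|/set0Pn[z zS]] := eqVneq (A :&: T) set0.
  have /card_gt0P[w wA] : 0 < #|A| by lia.
  have Aw := cardsD1 w A; rewrite wA in Aw.
  (* Without boundary, [w] starts a new [B]: its neighbours become boundary vertices, which pays for
     the edges lost at [w]. *)
  have := IH (A :\ w) [set w].
  rewrite connected_in1 disjoint_sym disjoints1 !inE eqxx => /(_ _ isT isT _).
  move=> /(_ ltac:(lia) ltac:(lia)).
  rewrite S0 cards0 (card_arcsD1 wA).
  have -> : (A :\ w) :&: [set v | touches e [set w] v] = [set v in A | e w v].
    apply/setP => v; rewrite !inE touches1; have [->|_] := eqVneq v w; last by [].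
    by rewrite e_irr !andbF.
  by lia.
have [|big] := boolP [exists z in A :&: T, #|[set v in A | touches e B v && e z v]| <= 2].
  case/exists_inP => w; rewrite !inE => /andP[wA tw] w2.
  have Aw := cardsD1 w A; rewrite wA in Aw.
  have := IH (A :\ w) (w |: B) ltac:(lia) (connected_inU1 e_sym cB tw)
    (disjoint_transfer _ dAB) ltac:(lia).
  rewrite (card_arcsD1 wA).
  set S' := (A :\ w) :&: _; set D := [set v in A | e w v].
  (* Removing [w] deletes it from the boundary and adds its interior neighbours; at most two
     boundary neighbours is just what the constants allow. *)
  have : #|S'| + #|[set v in A | touches e B v && e w v]| + 1 = #|A :&: T| + #|D|.
    have := cardsUI D (A :&: T); have := cardsD1 w (D :|: (A :&: T)).
    have -> : (D :|: (A :&: T)) :\ w = S'.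
      by apply/setP => v; rewrite !inE touchesU1; case: (v == w); case: (v \in A).
    have -> : D :&: (A :&: T) = [set v in A | touches e B v && e w v].
      by apply/setP => v; rewrite !inE; case: (v \in A); rewrite //= andbC.
    by rewrite !inE wA tw orbT; lia.
  by lia.
have zA : z \in A by case/setIP: zS.
have tz : touches e B z by case/setIP: zS => _; rewrite inE.
have z3 : 2 < #|[set v in A | touches e B v && e z v]|.
  by rewrite ltnNge; apply: contra big => z2; apply/exists_inP; exists z.
have [m [X [Y [mA tm cut]]]] := edge_cutP e_sym e_irr e_free cB dAB zA tz z3.
have cut' := edge_cutC e_sym cut.
have ltY := cut_card_lt cut; have ltX := cut_card_lt cut'.
have := card_cut cut (T := setT) (in_setT _) (in_setT _); rewrite !setIT => cA.
have dD (Z : {set V}) : [disjoint A :\: Z & B] by apply: disjointWl dAB; apply: subsetDl.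
have ge2 (Z Z' : {set V}) : edge_cut e A z m Z Z' -> 2 <= #|A :\: Z|.
  case=> ezm cA' _ /andP[zZ _] /andP[mZ _] _ _.
  have zm : z != m by apply: contraTneq ezm => ->; rewrite e_irr.
  have -> : 2 = #|[set z; m]| by rewrite cards2 zm.
  apply: subset_leq_card; apply/subsetP => v; rewrite in_set2 => /orP[]/eqP->.
    by rewrite inE zZ zA.
  by rewrite inE mZ mA.
(* The pieces count two vertices, two boundary vertices and the edge [zm] twice; in the sum of both
   bounds these cancel against the constants exactly. *)
have h1 := IH (A :\: Y) B ltac:(lia) cB (dD _) (ge2 _ _ cut').
have h2 := IH (A :\: X) B ltac:(lia) cB (dD _) (ge2 _ _ cut).
have hT : z \in T /\ m \in T by rewrite !inE.
have cT := card_cut cut (proj1 hT) (proj2 hT).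
have ce := card_arcs_cut cut.
by move: h1 h2 cT ce cA; rewrite -/T; clear; lia.
Qed.

End EdgeBound.

(** * Polynomial functions over the field with five elements *)

Import GRing.Theory.
Local Open Scope ring_scope.

Section PolynomialFunctions.
Variables (V : finType) (F : finFieldType).
Hypothesis F5 : #|F| = 5%N.
Implicit Types (s : seq V) (f g : {ffun V -> F} -> F) (c : {ffun V -> F}).

(* f is a polynomial of total degree at most d in the variables of s, of degree
   less than 5 in each of them. *)
Fixpoint degree_le s (d : nat) f : Prop :=
  if s is v :: s' then
    exists g : nat -> {ffun V -> F} -> F,
      (forall i, (i <= d)%N -> degree_le s' (d - i) (g i)) /\
      (forall c, f c = \sum_(i < 5 | (i <= d)%N) g i c * c v ^+ i)
  else exists k : F, forall c, f c = k.

Lemma degree_le_ext s d f g : f =1 g -> degree_le s d f -> degree_le s d g.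
Proof.
case: s => [|v s] fg /=.
  by case=> k fk; exists k => c; rewrite -fg.
by case=> h [hd fh]; exists h; split=> // c; rewrite -fg.
Qed.

Lemma degree_le_const s d k : degree_le s d (fun=> k).
Proof.
elim: s d k => [|v s IH] d k /=; first by exists k.
exists (fun i _ => if i == 0 then k else 0); split; first by move=> i _; apply: IH.
move=> c; rewrite (bigD1 ord0) //= expr0 mulr1 big1 ?addr0 // => i /andP[_].
by rewrite -val_eqE /= => /negPf->; rewrite mul0r.
Qed.

Lemma degree_le_add s d f g :
  degree_le s d f -> degree_le s d g -> degree_le s d (fun c => f c + g c).
Proof.
elim: s d f g => [|v s IH] d f g /=.
  by case=> k fk [l gl]; exists (k + l) => c; rewrite fk gl.
case=> a [ad fa] [b [bd gb]]; exists (fun i c => a i c + b i c); split.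
  by move=> i id; apply: IH; [apply: ad|apply: bd].
by move=> c; rewrite fa gb -big_split; apply: eq_bigr => i _; rewrite mulrDl.
Qed.

Lemma degree_le_scale s d (k : F) f :
  degree_le s d f -> degree_le s d (fun c => k * f c).
Proof.
elim: s d f => [|v s IH] d f /=.
  by case=> l fl; exists (k * l) => c; rewrite fl.
case=> a [ad fa]; exists (fun i c => k * a i c); split.
  by move=> i id; apply: IH; apply: ad.
by move=> c; rewrite fa mulr_sumr; apply: eq_bigr => i _; rewrite mulrA.
Qed.

Lemma degree_le_mono s d d' f : (d <= d')%N -> degree_le s d f -> degree_le s d' f.
Proof.
elim: s d d' f => [|v s IH] d d' f //= dd' [a [ad fa]].
exists (fun i c => if (i <= d)%N then a i c else 0); split.
  move=> i id'; case: (leqP i d) => id; last exact: degree_le_const.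
  by apply: IH (ad i id); apply: leq_sub2r.
move=> c; rewrite fa big_mkcond [RHS]big_mkcond; apply: eq_bigr => i _.
case: (leqP i d) => id; last by rewrite mul0r if_same.
by rewrite (leq_trans id dd').
Qed.

Lemma expF5 (x : F) : x ^+ 5 = x.
Proof. by rewrite -F5 expf_card. Qed.

(** Coefficients shift by one exponent; since [x ^+ 5 = x] on [F], exponent 4 wraps around to 1,
    which only lowers the degree. *)
Lemma degree_le_mulX s d f v : v \in s ->
  degree_le s d f -> degree_le s d.+1 (fun c => f c * c v).
Proof.
elim: s d f => [|w s IH] d f //=; rewrite inE.
have [-> _|vw /= vs] := eqVneq v w; last first.
  case=> a [ad fa]; exists (fun i c => (if (i <= d)%N then a i c else 0) * c v); split.
    move=> i id; case: (leqP i d) => id'.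
      by rewrite subSn //; apply: IH => //; apply: ad.
    apply: (degree_le_ext (f := fun=> 0)) => [c|]; first by rewrite mul0r.
    exact: degree_le_const.
  move=> c; rewrite fa mulr_suml big_mkcond [RHS]big_mkcond; apply: eq_bigr => i _.
  case: (leqP i d) => id; last by rewrite !mul0r if_same.
  by rewrite (leq_trans id (leqnSn d)) mulrAC.
case=> a [ad fa].
(* Coefficients beyond [d] become 0, so that sums run over all five exponents. *)
pose a' i c := if (i <= d)%N then a i c else 0.
have a'd i : (i <= d)%N -> degree_le s (d - i) (a' i).
  by move=> id; rewrite /a' id; apply: (degree_le_ext (f := a i)) => //; apply: ad.
have a'0 i c : (d < i)%N -> a' i c = 0 by move=> di; rewrite /a' leqNgt di.
have fa' c : f c = \sum_(i < 5) a' i c * c w ^+ i.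
  rewrite fa big_mkcond; apply: eq_bigr => i _; rewrite /a'.
  by case: (leqP i d); rewrite ?mul0r.
pose b i c := if i is j.+1 then a' j c + (if j == 0 then a' 4 c else 0) else 0.
have b0 i c : (d.+1 < i)%N -> b i c = 0.
  case: i => // i; rewrite ltnS /b => id; rewrite a'0 //.
  by case: eqP => [i0|_]; rewrite ?addr0 //; rewrite i0 in id.
exists b; split.
  case=> [|i] id; first exact: degree_le_const.
  rewrite subSS; apply: degree_le_add; first exact: a'd.
  case: (i == 0)%N / eqP => [->|_]; last exact: degree_le_const.
  case: (leqP 4 d) => d4.
    by apply: degree_le_mono (a'd 4 d4); apply: leq_sub2l.
  apply: (degree_le_ext (f := fun=> 0)) => [c|]; first by rewrite a'0.
  exact: degree_le_const.
move=> c; rewrite fa' [RHS]big_mkcond /=.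
transitivity (\sum_(i < 5) b i c * c w ^+ i); last first.
  apply: eq_bigr => i _; case: (leqP i d.+1) => // id.
  by rewrite b0 // mul0r.
rewrite !big_ord_recl !big_ord0 /b /= /bump /= !add1n /=.
apply/eqP; rewrite -subr_eq0; apply/eqP.
transitivity (a' 4 c * (c w ^+ 5 - c w)); first by ring.
by rewrite expF5 subrr mulr0.
Qed.

Definition subst c v (a : F) : {ffun V -> F} := [ffun u => if u == v then a else c u].

Lemma degree_le_subst s d f v c a :
  v \notin s -> degree_le s d f -> f (subst c v a) = f c.
Proof.
elim: s d f => [|w s IH] d f /=; first by move=> _ [k fk]; rewrite !fk.
rewrite inE negb_or => /andP[vw vs] [g [gd fg]]; rewrite !fg.
apply: eq_bigr => i id; rewrite ffunE eq_sym (negPf vw).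
by rewrite (IH _ _ vs (gd _ id)).
Qed.

(** The map from [(c, a)] to [(subst c v a, c v)] is a bijection, so every point arises from exactly
    five pairs. *)
Lemma card_subst (P : pred {ffun V -> F}) v :
  (\sum_(c : {ffun V -> F}) #|[set a | P (subst c v a)]| = 5 * #|[set c | P c]|)%N.
Proof.
transitivity (\sum_(p : {ffun V -> F} * F) P (subst p.1 v p.2))%N.
  rewrite -(pair_bigA _ (fun c a => (P (subst c v a) : nat))) /=.
  apply: eq_bigr => c _; rewrite -sum1_card big_mkcond; apply: eq_bigr => a _.
  by rewrite inE; case: (P _).
have inj : injective (fun p : {ffun V -> F} * F => (subst p.1 v p.2, p.1 v)).
  move=> [c a] [c' a'] [/ffunP h hv]; congr pair.
    by apply/ffunP => u; have := h u; rewrite !ffunE; case: eqP => [->|].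
  by have := h v; rewrite !ffunE eqxx.
rewrite -F5 -sum1_card mulnC big_distrl /=.
transitivity (\sum_(p : {ffun V -> F} * F) P p.1)%N.
  by rewrite [RHS](reindex_inj inj).
rewrite -(pair_bigA _ (fun c (_ : F) => (P c : nat))) /= [RHS]big_mkcond.
by apply: eq_bigr => c _; rewrite sum_nat_const inE; case: (P c); rewrite ?mul1n ?muln1 ?muln0.
Qed.

Lemma card_nonroots (a : nat -> F) (k : nat) : (k < 5)%N -> a k != 0 ->
  (5 - k <= #|[set x : F | (\sum_(i < k.+1) a i * x ^+ i != 0)%R]|)%N.
Proof.
move=> k5 ak; pose p := \poly_(i < k.+1) a i.
have p0 : p != 0.
  by apply: contra_neq ak => p0; have := coef_poly k.+1 a k; rewrite -/p p0 coef0 ltnSn.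
have pE x : p.[x] = \sum_(i < k.+1) a i * x ^+ i by rewrite horner_poly.
pose r := enum [set x : F | p.[x] == 0].
have : (size r < size p)%N.
  apply: max_poly_roots => //; rewrite ?enum_uniq //.
  by apply/allP => x; rewrite mem_enum inE.
have := size_poly k.+1 a; rewrite -/p -cardE => sp rp.
have rk : (#|[set x : F | p.[x] == 0%R]| <= k)%N by rewrite -ltnS (leq_trans rp).
rewrite (_ : [set x | _] = ~: [set x : F | p.[x] == 0]); last first.
  by apply/setP => x; rewrite !inE pE.
rewrite cardsCs setCK F5; exact: leq_sub2l.
Qed.

(** As a density: [f] is nonzero on at least a 5^(-d/4) fraction of all points, a smooth form of the
    Alon-Furedi bound. The induction peels off one variable and keeps its leading coefficient. *)
Theorem degree_le_card_nonroots s d f : uniq s -> degree_le s d f ->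
    (exists c, f c != 0) ->
  (5 ^ (4 * #|V|) <= 5 ^ d * #|[set c | (f c != 0)%R]| ^ 4)%N.
Proof.
elim: s d f => [|v s IH] d f /=.
  move=> _ [k fk] [c fc].
  rewrite (_ : [set c | _] = setT); last first.
    by apply/setP => c'; rewrite !inE fk -(fk c).
  by rewrite cardsT card_ffun F5 -expnM mulnC leq_pmull // expn_gt0.
move=> /andP[vs us] [g [gd fg]] [c0 fc0].
pose Q i := (i < 5)%N && (i <= d)%N && [exists c, g i c != 0].
have exQ : exists i, Q i.
  have [i /andP[id gi]] : exists i : 'I_5, (i <= d)%N && (g i c0 != 0).
    apply/existsP; apply: contraNT fc0 => /existsPn h; rewrite fg big1 // => i id.
    by have := h i; rewrite id negbK => /eqP->; rewrite mul0r.
  by exists i; rewrite /Q ltn_ord id; apply/existsP; exists c0.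
have Qb i : Q i -> (i <= 4)%N by case/andP => /andP[].
have [k /andP[/andP[k5 kd] /existsP gk] kmax] := ex_maxnP exQ Qb.
have := IH _ _ us (gd k kd) gk.
set N' := #|[set c | g k c != 0]|; set N := #|[set c | f c != 0]| => IHk.
(* The coefficients do not depend on [v], and maximality of [k] makes the higher ones vanish
   everywhere, so on the line through [c] in direction [v] the degree is [k]. *)
have sub c : g k c != 0 -> (5 - k <= #|[set a | f (subst c v a) != 0%R]|)%N.
  move=> gkc; apply: leq_trans (card_nonroots (a := fun i => g i c) k5 gkc) _.
  apply: subset_leq_card; apply/subsetP => a; rewrite !inE; apply: contraNN => /eqP fa.
  apply/eqP; rewrite -[RHS]fa fg; symmetry.
  transitivity (\sum_(i < 5 | (i <= k)%N) g i c * a ^+ i).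
    rewrite big_mkcond /= [RHS]big_mkcond /=; apply: eq_bigr => i _.
    rewrite ffunE eqxx; case: (leqP i k) => ik; last first.
      case: ifP => // id; suff -> : g i (subst c v a) = 0 by rewrite mul0r.
      apply: contraTeq ik => gi; rewrite -leqNgt; apply: kmax.
      by rewrite /Q ltn_ord id; apply/existsP; eexists; exact: gi.
    by rewrite (leq_trans ik kd) (degree_le_subst _ _ vs (gd i (leq_trans ik kd))).
  by rewrite (big_ord_narrow_leq (n2 := 4) k5).
have key : (N' * (5 - k) <= 5 * N)%N.
  rewrite -(card_subst (fun c => f c != 0) v) /N' -sum1_card big_distrl /=.
  rewrite big_mkcond; apply: leq_sum => c _; rewrite inE mul1n.
  by case: ifP => // /sub.
(* This is 1 - k/5 >= 5^(-k/4), with equality at k = 0 and k = 4. *)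
have k4 : (5 ^ 4 <= (5 - k) ^ 4 * 5 ^ k)%N.
  by case: (k) k5 => [|[|[|[|[|]]]]].
have : ((N' * (5 - k)) ^ 4 <= (5 * N) ^ 4)%N by rewrite leq_exp2r.
rewrite !expnMn => key4.
rewrite -(leq_pmul2l (m := 5 ^ 4)) ?expn_gt0 //.
apply: (leq_trans (leq_mul k4 IHk)).
rewrite -[in (5 ^ d)%N](subnKC kd) expnD.
move: key4; move: (5 ^ 4)%N (5 ^ k)%N (5 ^ (d - k))%N ((5 - k) ^ 4)%N => a b p q key4.
rewrite (_ : _ * _ = b * p * (N' ^ 4 * q))%N; last by ring.
by rewrite (_ : a * _ = b * p * (a * N ^ 4))%N; [rewrite leq_mul|ring].
Qed.

End PolynomialFunctions.

(** * Parity of windings of polygonal chains *)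

Import Order.TTheory Num.Theory.

Section DiscreteWinding.
Variable (R : realFieldType) (d : R).
Implicit Types (a b u v w q : R * R) (s t : seq (R * R)).

Definition d_close u v : bool :=
  [&& u.1 - v.1 < d, v.1 - u.1 < d, u.2 - v.2 < d & v.2 - u.2 < d].

Definition large u : bool :=
  [|| 4 * d <= u.1, u.1 <= - (4 * d), 4 * d <= u.2 | u.2 <= - (4 * d)].

(* For d-close large u and v, whether the segment uv crosses the positive
   x-axis; the parity of these crossings replaces the winding angle. *)
Definition crossing u v : bool := ((u.2 < 0) (+) (v.2 < 0)) && (0 < u.1).

(** Lexicographic sign, second coordinate first. Unlike the sign of the ordinate alone, it is
    reversed by negating any nonzero vector. *)
Definition lexneg u : bool := (u.2 < 0) || (u.2 == 0) && (u.1 < 0).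

Fixpoint crossings (f : R * R -> R * R) a s : bool :=
  if s is b :: s' then crossing (f a) (f b) (+) crossings f b s' else false.

Lemma sign_cases (x : R) :
  [\/ [/\ x < 0, (x < 0) = true, (0 < x) = false & (x == 0) = false],
      [/\ 0 < x, (x < 0) = false, (0 < x) = true & (x == 0) = false] |
      [/\ x = 0, (x < 0) = false, (0 < x) = false & (x == 0) = true]].
Proof.
case: (ltrgtP x 0) => h; [constructor 1|constructor 2|constructor 3]; split=> //.
Qed.

(** Negation exchanges the two halves of the x-axis, so the sum counts changes of side of the whole
    axis; [lexneg] decides the side of points on it. *)
Lemma crossing_opp u v : d_close u v -> large u -> large v ->
  crossing u v (+) crossing (- u) (- v) = lexneg u (+) lexneg v.
Proof.
case: u v => [u1 u2] [v1 v2].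
rewrite /d_close /large /crossing /lexneg /= !oppr_lt0 !oppr_gt0.
move=> /and4P[h1 h2 h3 h4] hu hv.
case: (sign_cases u2) => -[hu2 -> -> ->]; case: (sign_cases v2) => -[hv2 -> -> ->] //=;
have {}hu : 4 * d <= u1 \/ u1 <= - (4 * d) by
  case/or4P: hu => ?; [left|right|exfalso|exfalso] => //; lra.
all: have {}hv : 4 * d <= v1 \/ v1 <= - (4 * d) by
  case/or4P: hv => ?; [left|right|exfalso|exfalso] => //; lra.
all: have [[p q]|[p q]] : (0 < u1 /\ 0 < v1) \/ (u1 < 0 /\ v1 < 0) by
  clear -h1 h2 hu hv; case: hu hv => hu [] hv;
  [left; split|exfalso|exfalso|right; split]; lra.
all: by rewrite ?p ?q ?(lt_gtF p) ?(lt_gtF q).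
Qed.

Definition d_close2 u v : bool :=
  [&& u.1 - v.1 < 2 * d, v.1 - u.1 < 2 * d, u.2 - v.2 < 2 * d & v.2 - u.2 < 2 * d].

Lemma d_close2C u v : d_close2 u v -> d_close2 v u.
Proof. by case/and4P=> *; apply/and4P; split. Qed.

Lemma d_close_close2 u v : d_close u v -> d_close2 u v.
Proof. by move=> /and4P[*]; apply/and4P; split; lra. Qed.

Lemma d_close2_trans u v w : d_close u v -> d_close v w -> d_close2 u w.
Proof. by move=> /and4P[? ? ? ?] /and4P[*]; apply/and4P; split; lra. Qed.

Lemma d_closeC u v : d_close u v = d_close v u.
Proof. by apply/and4P/and4P => -[*]; split. Qed.

(** As [u] and [v] straddle the x-axis, the ordinates of [w] and [z] are small; being large, these
    vectors have abscissas of modulus at least [4 * d], and being close, of equal sign. *)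
Lemma same_side u v w z :
    (u.2 < 0) != (v.2 < 0) -> d_close2 u v -> d_close2 u w -> d_close2 v w ->
    d_close2 u z -> d_close2 v z -> d_close2 w z -> large w -> large z ->
  (0 < w.1) = (0 < z.1).
Proof.
move=> uv /and4P[_ _ a3 a4] /and4P[_ _ b3 b4] /and4P[_ _ c3 c4].
move=> /and4P[_ _ d3 d4] /and4P[_ _ e3 e4] /and4P[f1 f2 _ _].
have {}uv : u.2 < 0 <= v.2 \/ v.2 < 0 <= u.2.
  by move: uv; case: (ltP u.2 0) => //; case: (ltP v.2 0) => //; [left|right].
move=> lw lz.
have {}lw : 4 * d <= w.1 \/ w.1 <= - (4 * d).
  by case/or4P: lw => ?; [left|right|exfalso|exfalso] => //; case: uv => /andP[? ?]; lra.
have {}lz : 4 * d <= z.1 \/ z.1 <= - (4 * d).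
  by case/or4P: lz => ?; [left|right|exfalso|exfalso] => //; case: uv => /andP[? ?]; lra.
have d0 : 0 < 4 * d by lra.
case: lw lz => lw [] lz; try (exfalso; lra).
  by rewrite !(lt_le_trans d0).
have d1 : - (4 * d) < 0 by rewrite oppr_lt0.
by rewrite (lt_gtF (le_lt_trans lw d1)) (lt_gtF (le_lt_trans lz d1)).
Qed.

(** Homotopy invariance across one cell: once a side crosses the axis, [same_side] gives all corners
    the same value of [0 < u.1], and the crossings cancel around the cell. *)
Lemma crossing_cell u0 u1 u2 u3 :
    d_close u0 u1 -> d_close u1 u2 -> d_close u3 u2 -> d_close u0 u3 ->
    large u0 -> large u1 -> large u2 -> large u3 ->
  crossing u0 u1 (+) crossing u1 u2 = crossing u0 u3 (+) crossing u3 u2.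
Proof.
move=> c01 c12 c32 c03 l0 l1 l2 l3.
have c02 := d_close2_trans c01 c12.
have c13 : d_close2 u1 u3 by apply: d_close2_trans c12 _; rewrite d_closeC.
move: c01 c12 c32 c03 => /d_close_close2 c01 /d_close_close2 c12 /d_close_close2 c32 /d_close_close2 c03.
have c u : d_close2 u u by case/and4P: c01 => *; apply/and4P; split; rewrite subrr; lra.
have C := (c, c01, c12, c32, c03, c02, c13).
have C' := (d_close2C c01, d_close2C c12, d_close2C c32, d_close2C c03, d_close2C c02, d_close2C c13).
have side u v : d_close2 u v -> all (d_close2 u) [:: u0; u1; u2; u3] ->
    all (d_close2 v) [:: u0; u1; u2; u3] -> ((u.2 < 0) != (v.2 < 0)) ==>
    [&& (0 < u0.1) == (0 < u1.1), (0 < u0.1) == (0 < u2.1) & (0 < u0.1) == (0 < u3.1)].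
  move=> cuv /and5P[? ? ? ? _] /and5P[? ? ? ? _]; apply/implyP => uv.
  by apply/and3P; split; apply/eqP/(same_side uv); rewrite ?c ?C ?C'.
have S01 := side u0 u1; have S12 := side u1 u2; have S32 := side u3 u2; have S03 := side u0 u3.
rewrite /= !c !c01 !c12 !c32 !c03 !c02 !c13 !(d_close2C c01) !(d_close2C c12) !(d_close2C c32)
  !(d_close2C c03) !(d_close2C c02) !(d_close2C c13) /= in S01 S12 S32 S03.
move: (S01 isT isT isT) (S12 isT isT isT) (S32 isT isT isT) (S03 isT isT isT).
rewrite /crossing; move: (u0.2 < 0) (u1.2 < 0) (u2.2 < 0) (u3.2 < 0).
move: (0 < u0.1) (0 < u1.1) (0 < u2.1) (0 < u3.1).
by do 8!case.
Qed.

Lemma d_close_subr q u v : d_close (u - q) (v - q) = d_close u v.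
Proof.
case: q u v => [q1 q2] [u1 u2] [v1 v2]; rewrite /d_close /=.
by rewrite !opprB !addrA !addrNK.
Qed.

Lemma d_close_subl q u v : d_close (q - u) (q - v) = d_close u v.
Proof.
case: q u v => [q1 q2] [u1 u2] [v1 v2]; rewrite /d_close /=.
rewrite !opprB !addrA.
rewrite (_ : q1 - u1 + v1 - q1 = v1 - u1); last by ring.
rewrite (_ : q1 - v1 + u1 - q1 = u1 - v1); last by ring.
rewrite (_ : q2 - u2 + v2 - q2 = v2 - u2); last by ring.
rewrite (_ : q2 - v2 + u2 - q2 = u2 - v2); last by ring.
by rewrite andbCA; congr (_ && (_ && _)); rewrite andbC.
Qed.

Lemma crossings_strip a a' b t :
    d_close a a' -> path d_close b t ->
    {in b :: t, forall y, large (a - y) && large (a' - y)} ->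
  crossing (a - b) (a' - b) (+) crossings (fun y => a' - y) b t =
  crossings (fun y => a - y) b t (+) crossing (a - last b t) (a' - last b t).
Proof.
move=> caa; elim: t b => [|b' t IH] b /=; first by rewrite addbF.
case/andP => cbb /IH{}IH far.
have /andP[l1 l2] := far b (mem_head _ _).
have /andP[l3 l4] : large (a - b') && large (a' - b') by apply: far; rewrite !inE eqxx orbT.
rewrite addbA (crossing_cell (u3 := a - b')) ?d_close_subr ?d_close_subl //.
by rewrite -!addbA; congr (_ (+) _); apply: IH => y yt; apply: far; rewrite inE yt orbT.
Qed.

Lemma crossings_square a s b t :
    path d_close a s -> path d_close b t ->
    {in a :: s & b :: t, forall x y, large (x - y)} ->
  crossings (fun x => x - b) a s (+) crossings (fun y => last a s - y) b t =
  crossings (fun y => a - y) b t (+) crossings (fun x => x - last b t) a s.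
Proof.
move=> + pt; elim: s a => [|a' s IH] a /=; first by rewrite addbF.
case/andP => caa /IH{}IH far.
rewrite -addbA IH; last by move=> x y xs; apply: far; rewrite inE xs orbT.
rewrite !addbA; congr (_ (+) _); apply: crossings_strip => // y yt.
by rewrite !far ?inE ?eqxx ?orbT.
Qed.

Definition winding q b t : bool := crossings (fun y => y - q) b t.

Lemma crossings_opp q b t :
    path d_close b t -> {in b :: t, forall y, large (y - q)} ->
  crossings (fun y => q - y) b t = winding q b t (+) lexneg (b - q) (+) lexneg (last b t - q).
Proof.
rewrite /winding; elim: t b => [|b' t IH] b /=; first by rewrite addbb.
case/andP => cbb /IH{}IH far; rewrite IH; last first.
  by move=> y yt; apply: far; rewrite inE yt orbT.
have l1 := far b (mem_head _ _).
have l2 : large (b' - q) by apply: far; rewrite !inE eqxx orbT.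
have := crossing_opp (u := b - q) (v := b' - q); rewrite d_close_subr !opprB => /(_ cbb l1 l2).
move: (crossing _ _) (crossing _ _) (crossings _ _ _) (lexneg _) (lexneg _) (lexneg _).
by do 6!case.
Qed.

Lemma large_opp u : large (- u) = large u.
Proof.
case: u => u1 u2; rewrite /large /= !(lerNr (4 * d)) ![_ <= - (4 * d)]lerNr !opprK.
by rewrite orbCA; congr (_ || (_ || _)); rewrite orbC.
Qed.

(** In [crossings_square] two sides are windings of [a :: s] around the ends of [b :: t]. The other
    two run over [a - y] and [last a s - y]; reversing their sign by [crossings_opp] brings in the
    order terms. *)
Lemma winding_square a s b t :
    path d_close a s -> path d_close b t ->
    {in a :: s & b :: t, forall x y, large (x - y)} ->
  winding b a s (+) winding (last b t) a s (+) (winding a b t (+) winding (last a s) b t) =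
  lexneg (b - a) (+) lexneg (last b t - a) (+)
  (lexneg (b - last a s) (+) lexneg (last b t - last a s)).
Proof.
move=> ps pt far; have := crossings_square ps pt far.
have far' y x : y \in b :: t -> x \in a :: s -> large (y - x).
  by move=> yt xs; rewrite -large_opp opprB far.
rewrite !crossings_opp //; try by move=> y yt; apply: far' => //; rewrite ?mem_last ?mem_head.
rewrite -/(winding b a s) -/(winding (last b t) a s).
move: (winding b a s) (winding (last b t) a s) (winding a b t) (winding (last a s) b t).
move: (lexneg _) (lexneg _) (lexneg _) (lexneg _).
by do 8!case.
Qed.

Lemma lexneg_anti u : u != 0 -> lexneg (- u) = ~~ lexneg u.
Proof.
case: u => u1 u2; rewrite /lexneg /= !oppr_lt0 oppr_eq0 xpair_eqE negb_and.
case: (sign_cases u2) => -[_ -> -> ->]; rewrite ?orbT //=.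
by case: (sign_cases u1) => -[_ -> -> ->].
Qed.

Lemma large_neq0 u : 0 < d -> large u -> u != 0.
Proof.
move=> d0; apply: contraTneq => ->; rewrite /large /= !oppr_ge0.
by rewrite !leNgt !pmulr_rgt0 ?d0.
Qed.

(* Only independent edges are required to be disjoint; adjacent edges may meet
   arbitrarily, so that the edges of a minor can be routed through its bags. *)
Definition almost_drawing (n : nat) (r : nat -> nat -> bool)
    (p : nat -> R * R) (c : nat -> nat -> seq (R * R)) : Prop :=
  (forall i j, (i < j < n)%N -> r i j -> path d_close (p i) (c i j) /\ last (p i) (c i j) = p j) /\
  (forall i j k l, (i < j < n)%N -> (k < l < n)%N -> r i j -> r k l -> uniq [:: i; j; k; l] ->
     {in p i :: c i j & p k :: c k l, forall x y, large (x - y)}).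

(** * Summation over pairs of independent edges *)

Section Parity.
Variables (n : nat) (r : nat -> nat -> bool) (p : nat -> R * R) (c : nat -> nat -> seq (R * R)).
Hypotheses (d_gt0 : 0 < d) (dr : almost_drawing n r p c).

(** Booleans are read as 0 or 1, so that the sum over all squares becomes linear arithmetic over
    [nat]. *)
Definition winding_number k i j : nat := winding (p k) (p i) (c i j).
Definition lexorder i j : nat := lexneg (p j - p i).
Local Notation w := winding_number.
Local Notation o := lexorder.

Definition square_sum (x : nat * nat * (nat * nat)) : nat :=
  let: ((i, j), (k, l)) := x in
  (w k i j + w l i j + w i k l + w j k l + (o i k + o i l + o j k + o j l))%N.

Definition independent (x : nat * nat * (nat * nat)) : bool :=
  let: ((i, j), (k, l)) := x in
  [&& i < j < n, k < l < n, r i j, r k l & uniq [:: i; j; k; l]]%N.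

Lemma square_sum_even x : independent x -> odd (square_sum x) = false.
Proof.
case: x => [[i j] [k l]] /= /and5P[ij kl rij rkl u]; case: dr => dr1 dr2.
have [p1 l1] := dr1 i j ij rij; have [p2 l2] := dr1 k l kl rkl.
have := winding_square p1 p2 (dr2 _ _ _ _ ij kl rij rkl u); rewrite l1 l2.
rewrite !oddD /winding_number /lexorder !oddb.
move: (winding _ _ _) (winding _ _ _) (winding _ _ _) (winding _ _ _).
by move: (lexneg _) (lexneg _) (lexneg _) (lexneg _); do 8!case.
Qed.

Lemma sum_square_even (L : seq (nat * nat * (nat * nat))) :
  all independent L -> odd (sumn (map square_sum L)) = false.
Proof.
elim: L => //= x L IH /andP[/square_sum_even ox /IH oL].
by rewrite oddD ox oL.
Qed.

Lemma order_anti i j : p i - p j != 0 -> (o i j + o j i = 1)%N.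
Proof.
by rewrite /lexorder => pij; rewrite -[p j - p i]opprB lexneg_anti //; case: (lexneg _).
Qed.

Lemma independent_neq i j k l : independent ((i, j), (k, l)) ->
  [/\ (o i k + o k i = 1)%N, (o i l + o l i = 1)%N, (o j k + o k j = 1)%N & (o j l + o l j = 1)%N].
Proof.
move=> /and5P[ij kl rij rkl u]; case: dr => dr1 dr2.
have [p1 l1] := dr1 i j ij rij; have [p2 l2] := dr1 k l kl rkl.
have far := dr2 _ _ _ _ ij kl rij rkl u.
by split; apply: order_anti; apply: (large_neq0 d_gt0); apply: far;
  rewrite -?l1 -?l2 ?mem_last ?mem_head.
Qed.

End Parity.

(* van Kampen's obstruction: every winding number occurs in an even number of
   the squares, whereas the number of interleaving pairs of independent edges
   is 5 for K_5 and 9 for K_{3,3}. *)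
Lemma no_K5_drawing p c : 0 < d -> ~ almost_drawing 5 (fun _ _ => true) p c.
Proof.
move=> d0 dr.
pose L : seq (nat * nat * (nat * nat)) :=
  [:: ((0, 1), (2, 3)); ((0, 1), (2, 4)); ((0, 1), (3, 4));
    ((0, 2), (1, 3)); ((0, 2), (1, 4)); ((0, 2), (3, 4));
    ((0, 3), (1, 2)); ((0, 3), (1, 4)); ((0, 3), (2, 4));
    ((0, 4), (1, 2)); ((0, 4), (1, 3)); ((0, 4), (2, 3));
    ((1, 2), (3, 4)); ((1, 3), (2, 4)); ((1, 4), (2, 3))]%N.
have anti := independent_neq d0 dr.
have [_ _ o12 o13] := anti 0%N 1%N 2%N 3%N isT.
have [_ _ _ o14] := anti 0%N 1%N 2%N 4%N isT.
have [_ _ o23 o24] := anti 0%N 2%N 3%N 4%N isT.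
have [_ _ _ o34] := anti 0%N 3%N 1%N 4%N isT.
(* The total is even, yet every winding occurs twice, and exchanging the reversed order terms by the
   equations from [anti] leaves an odd constant besides even multiples. *)
have E := odd_double_half (sumn (map (square_sum p c) L)).
rewrite (sum_square_even dr (L := L) isT) add0n in E; move: E.
move: (_./2) => m; rewrite /L /=; clear L.
clear -o12 o13 o14 o23 o24 o34; lia.
Qed.

Lemma no_K33_drawing p c : 0 < d -> ~ almost_drawing 6 (fun i j => i < 3 <= j)%N p c.
Proof.
move=> d0 dr.
pose L : seq (nat * nat * (nat * nat)) :=
  [:: ((0, 3), (1, 4)); ((0, 3), (1, 5)); ((0, 3), (2, 4));
    ((0, 3), (2, 5)); ((0, 4), (1, 3)); ((0, 4), (1, 5));
    ((0, 4), (2, 3)); ((0, 4), (2, 5)); ((0, 5), (1, 3));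
    ((0, 5), (1, 4)); ((0, 5), (2, 3)); ((0, 5), (2, 4));
    ((1, 3), (2, 4)); ((1, 3), (2, 5)); ((1, 4), (2, 3));
    ((1, 4), (2, 5)); ((1, 5), (2, 3)); ((1, 5), (2, 4))]%N.
have anti := independent_neq d0 dr.
have [_ _ o14 o34] := anti 0%N 4%N 1%N 3%N isT.
have [_ _ o13 o35] := anti 0%N 3%N 1%N 5%N isT.
have [_ _ o15 o45] := anti 0%N 5%N 1%N 4%N isT.
have [_ _ o23 _] := anti 0%N 3%N 2%N 4%N isT.
have [_ _ o24 _] := anti 0%N 4%N 2%N 5%N isT.
have [_ _ o25 _] := anti 0%N 5%N 2%N 3%N isT.
have E := odd_double_half (sumn (map (square_sum p c) L)).
rewrite (sum_square_even dr (L := L) isT) add0n in E; move: E.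
move: (_./2) => m; rewrite /L /=; clear L.
clear -o14 o34 o13 o35 o15 o45 o23 o24 o25; lia.
Qed.
End DiscreteWinding.

(** * From plane embeddings to excluded minors *)

(* Loaded only here because classical_sets shadows many names of finset. *)
From mathcomp Require Import all_classical all_reals all_analysis.
Import numFieldNormedType.Exports.
Local Open Scope classical_set_scope.

(** * Chains in connected sets and separation of compact sets *)

Section Chains.
Variable R : realType.
Implicit Types (d : R) (x y : R * R) (A B : set (R * R)).

Lemma d_close_ball d x y : ball x d y -> d_close d x y.
Proof.
case=> /=; rewrite -!ball_normE /ball_ /= !ltr_norml => /andP[? ?] /andP[? ?].
by apply/and4P; split; lra.
Qed.

Lemma large_ball d x y : ~ ball x (4 * d) y -> large d (x - y).
Proof.
case: x y => [x1 x2] [y1 y2]; apply: contra_notT; rewrite /large !negb_or -!ltNge /=.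
move=> /and4P[? ? ? ?].
by split; rewrite -ball_normE /ball_ /= ltr_norml; apply/andP; split; lra.
Qed.

(** The points reached by such chains form a relatively open and closed subset of [A]. *)
Lemma connected_chain d A x y : 0 < d -> connected A -> A x -> A y ->
  exists s, [/\ path (d_close d) x s, last x s = y & forall z, z \in x :: s -> A z].
Proof.
move=> d0 cA Ax Ay.
pose S := [set y | exists s, [/\ path (d_close d) x s, last x s = y & forall z, z \in x :: s -> A z]].
have SA : S `<=` A by move=> z [s [_ <- sA]]; apply: sA; exact: mem_last.
have step z w : S z -> A w -> ball z d w -> S w.
  move=> [s [ps <- sA]] Aw zw; exists (rcons s w); split.
  - by rewrite rcons_path ps /=; apply: d_close_ball.
  - by rewrite last_rcons.
  - by move=> v; rewrite -rcons_cons mem_rcons inE => /orP[/eqP->|/sA].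
suff : S y by [].
suff -> : S = A by [].
apply: cA.
- by exists x, [::]; split=> // z; rewrite inE => /eqP->.
- exists (\bigcup_(z in S) ball z d).
    by apply: bigcup_open => z _; apply: ball_open.
  apply/seteqP; split=> [z Sz|z [Az [w Sw wz]]]; last exact: step Sw Az wz.
  by split; [exact: SA|exists z => //; apply: ballxx].
- exists (~` \bigcup_(z in A `\` S) ball z d).
    by apply: open_closedC; apply: bigcup_open => z _; apply: ball_open.
  apply/seteqP; split=> [z Sz|z [Az nz]].
    split; first exact: SA.
    by case=> w [Aw nSw] /ball_sym wz; apply: nSw; apply: step Sz Aw wz.
  by apply: contrapT => nS; apply: nz; exists z => //; apply: ballxx.
Qed.

(** Disjoint compact sets have positive distance; stating it for all small [d] lets finitely many
    pairs share one [d]. *)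
Lemma compact_disjoint_large A B : compact A -> compact B -> A `&` B = set0 ->
  \forall d \near 0^'+, forall x y, A x -> B y -> large d (x - y).
Proof.
move=> cA cB AB0.
have cBc : open (~` B) by apply: closed_openC; apply: compact_closed => //; exact: norm_hausdorff.
have /compact_near_coveringP := cA.
pose P d x := forall y, B y -> large d (x - y).
have F : Filter (0 : R)^'+ by exact: at_right_proper_filter.
suff H : forall x, A x -> \forall x' \near x & d \near (0 : R)^'+, P d x'.
  by move=> /(_ R _ P F H); apply: filterS => d dAB x y Ax By; apply: (dAB x Ax y By).
move=> x Ax.
have : nbhs x (~` B).
  by apply: open_nbhs_nbhs; split=> // Bx; have : (A `&` B) x by []; rewrite AB0.
move=> /nbhs_ballP xB; have [r [r0 xrB]] : exists r : R, 0 < r /\ ball x r `<=` ~` B.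
  by case: xB => r /= r0 xrB; exists r.
near=> z d.
have xz : ball x (r / 2) z by near: z; exact: nbhsx_ballx (divr_gt0 r0 _).
(* A point [y] within [4 * d <= r / 2] of [z] would lie in the ball of radius [r] around [x], which
   misses [B]. *)
have dr : d <= r / 8 by near: d; apply: nbhs_right_le; exact: divr_gt0.
move=> y By; apply: large_ball => zy; apply: (xrB y) => //.
have -> : r = r / 2 + r / 2 by lra.
by apply: ball_triangle xz _; apply: le_ball zy => /=; lra.
Unshelve. all: by end_near.
Qed.

End Chains.

(** * Drawing the minors of a plane graph by chains *)

Section Planarity.
Variables (R : realType) (V : finType) (e : rel V).
Hypotheses (e_sym : symmetric e) (e_irr : irreflexive e).
Variables (p : V -> R * R) (A : {set V} -> set (R * R)).
Hypothesis pA : plane_embedding e p A.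

(** The degenerate case keeps the points of the vertices of [U] in [region U], even when [U] spans
    no edge. *)
Definition piece (u v : V) : set (R * R) := if e u v then A (edge u v) else [set p u].

Lemma simple_arc_compact (x y : R * R) (C : set (R * R)) : simple_arc x y C -> compact C.
Proof.
case=> f [fc _ _ _ ->]; apply: continuous_compact => //; exact: segment_compact.
Qed.

Lemma simple_arc_connected (x y : R * R) (C : set (R * R)) : simple_arc x y C -> connected C.
Proof.
case=> f [fc _ _ _ ->]; apply: connected_continuous_connected => //; exact: segment_connected.
Qed.

Lemma simple_arc_ends (x y : R * R) (C : set (R * R)) : simple_arc x y C -> C x /\ C y.
Proof.
case=> f [_ _ <- <- ->]; split; [exists 0|exists 1] => //=; rewrite in_itv /= ?lexx ?ler01 //.
Qed.

Lemma piece_compact (u v : V) : compact (piece u v).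
Proof.
rewrite /piece; case: ifP => [euv|_]; last exact: compact_set1.
by have [/simple_arc_compact] := pA.2 u v euv.
Qed.

Lemma edge_vertex (u v w : V) : e u v -> A (edge u v) (p w) -> (w == u) || (w == v).
Proof.
move=> euv Aw; have [_ nw _] := pA.2 u v euv; apply/negbNE/negP => /norP[wu wv].
apply: (nw w); split=> // -[/pA.1 wu'|/pA.1 wv']; first by rewrite wu' eqxx in wu.
by rewrite wv' eqxx in wv.
Qed.

Lemma piece_disjoint (u v x y : V) :
    [&& u != x, u != y, v != x & v != y] -> piece u v `&` piece x y = set0.
Proof.
move=> /and4P[ux uy vx vy]; rewrite /piece.
case: ifP => [euv|nuv]; case: ifP => [exy|nxy]; apply/seteqP; split=> // z [].
- move=> Auv Axy; have [_ _ /(_ x y exy)] := pA.2 u v euv.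
  have ne : edge x y <> edge u v.
    move/finset.setP/(_ u); rewrite !inE eqxx /= => /eqP.
    by rewrite (negPf ux) (negPf uy).
  move=> /(_ ne) I0.
  have [zuv|nzuv] := pselect ([set p u; p v] z); last first.
    by have : ((A (edge u v) `\` [set p u; p v]) `&` A (edge x y)) z by []; rewrite I0.
  case: zuv => zE; rewrite zE in Axy.
    by have := edge_vertex exy Axy; rewrite (negPf ux) (negPf uy).
  by have := edge_vertex exy Axy; rewrite (negPf vx) (negPf vy).
- move=> Auv zE; rewrite zE in Auv.
  by have := edge_vertex euv Auv; rewrite ![x == _]eq_sym (negPf ux) (negPf vx).
- move=> zE Axy; rewrite zE in Axy.
  by have := edge_vertex exy Axy; rewrite (negPf ux) (negPf uy).
- by move=> -> /pA.1 uxE; rewrite uxE eqxx in ux.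
Qed.

Lemma pieces_large : \forall d \near (0 : R)^'+, forall u v x y,
  [&& u != x, u != y, v != x & v != y] ->
  forall a b, piece u v a -> piece x y b -> large d (a - b).
Proof.
have F : Filter (0 : R)^'+ by exact: at_right_proper_filter.
do 4!(apply: filter_forall => ?).
case: (boolP [&& _, _, _ & _]) => [dis|_]; last by near=> d.
have := compact_disjoint_large (@piece_compact _ _) (@piece_compact _ _) (piece_disjoint dis).
by apply: filterS => d h _ a b; apply: h.
Unshelve. all: by end_near.
Qed.

Definition region (U : {set V}) : set (R * R) :=
  [set a | exists u v, [/\ u \in U, v \in U & piece u v a]].

Lemma region_chain (d : R) (U : {set V}) (u v : V) :
    0 < d -> connected_in e U -> u \in U -> v \in U ->
  exists s, [/\ path (d_close d) (p u) s, last (p u) s = p v &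
                forall z, z \in p u :: s -> region U z].
Proof.
move=> d0 /connected_inP cU uU vU; have /connectP[q qp ->] := cU u v uU vU.
elim: q u uU qp {v vU cU} => [|w q IH] u uU /=.
  move=> _; exists [::]; split=> // z; rewrite inE => /eqP->.
  by exists u, u; rewrite /piece e_irr.
case/andP=> /and3P[_ wU euw] /IH[//|s [ps ls sU]].
have [arc _ _] := pA.2 u w euw; have [Au Aw] := simple_arc_ends arc.
have [t [pt lt tA]] := connected_chain d0 (simple_arc_connected arc) Au Aw.
exists (t ++ s); split.
- by rewrite cat_path pt lt.
- by rewrite last_cat lt.
- move=> z; rewrite -cat_cons mem_cat => /orP[/tA Az|zs].
    by exists u, w; rewrite /piece euw.
  by apply: sU; rewrite inE zs orbT.
Qed.

(** Each bag gets a representative, and an edge is drawn by a chain through the union of its two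
    bags, which is connected. Independent edges use four disjoint bags, so [pieces_large] keeps
    their chains apart. *)
Lemma minor_drawing (n : nat) (r : rel nat) (B : nat -> {set V}) :
    minor_bags e n.+1 r B ->
  exists (d : R) q c, 0 < d /\ almost_drawing d n.+1 r q c.
Proof.
case=> Bc B0 Bd Br.
have [d [d0 dl]] : exists d : R, 0 < d /\ forall u v x y,
    [&& u != x, u != y, v != x & v != y] ->
    forall a b, piece u v a -> piece x y b -> large d (a - b).
  near (0 : R)^'+ => d; exists d; split; first by near: d; exact: nbhs_right_gt.
  by near: d; exact: pieces_large.
have /choice[b bB] : forall i, exists v, (i < n.+1)%N -> v \in B i.
  (* [v0] is the value at indices that carry no bag; bag 0 provides it, which is why the number of
     bags is [n.+1]. *)
  have /set0Pn[v0 _] := B0 0%N isT.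
  move=> i; have [/B0/set0Pn[v vB]|_] := boolP (i < n.+1)%N; first by exists v.
  by exists v0.
pose P (ij : nat * nat) (s : seq (R * R)) := (ij.1 < ij.2 < n.+1)%N -> r ij.1 ij.2 ->
  [/\ path (d_close d) (p (b ij.1)) s, last (p (b ij.1)) s = p (b ij.2) &
      forall z, z \in p (b ij.1) :: s -> region (B ij.1 :|: B ij.2) z].
have /choice[c cP] : forall ij, exists s, P ij s.
  move=> [i j].
  have [/andP[ij rij]|nij] := boolP ((i < j < n.+1)%N && r i j); last first.
    by exists [::] => ij rij; rewrite ij rij in nij.
  have /andP[ij1 jn] := ij; have iN := ltn_trans ij1 jn.
  have [v vj /touchesP[u ui euv]] := Br i j ij rij.
  have cU : connected_in e (B i :|: B j).
    by apply: (connected_inU e_sym (Bc i iN) (Bc j jn) ui vj); rewrite euv orbT.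
  have [|//|s [ps ls sU]] := region_chain d0 cU (u := b i) (v := b j).
  - by rewrite finset.inE bB.
  - by rewrite finset.inE bB ?orbT.
  by exists s => _ _.
exists d, (p \o b), (fun i j => c (i, j)); split=> //; split.
  by move=> i j ij rij; have [] := cP (i, j) ij rij.
move=> i j k l ij kl rij rkl u x y xij ykl.
have [_ _ /(_ x xij) [u1 [v1 [u1U v1U ux]]]] := cP (i, j) ij rij.
have [_ _ /(_ y ykl) [u2 [v2 [u2U v2U uy]]]] := cP (k, l) kl rkl.
apply: dl ux uy; rewrite /= !finset.inE in u1U v1U u2U v2U.
have Bne s t w w' : (s < n.+1)%N -> (t < n.+1)%N -> s != t -> w \in B s -> w' \in B t -> w != w'.
  move=> sn tn st ws wt; apply: contraTneq ws => ->.
  by case: (ltngtP s t) st => // [st|ts] _;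
    [rewrite (disjointFl (Bd s t _) wt) ?st|rewrite (disjointFr (Bd t s _) wt) ?ts].
move: ij kl u => /andP[ij jn] /andP[kl ln] /=.
have iN := ltn_trans ij jn; have kN := ltn_trans kl ln.
rewrite !inE !negb_or -!andbA => /and5P[_ ik il jk /andP[jl _]].
have H w w' : (w \in B i) || (w \in B j) -> (w' \in B k) || (w' \in B l) -> w != w'.
  by move=> /orP[] wi /orP[] wk; [apply: (Bne i k)|apply: (Bne i l)|apply: (Bne j k)|apply: (Bne j l)].
by apply/and4P; split; apply: H.
Unshelve. all: by end_near.
Qed.

Theorem planar_kuratowski_free : kuratowski_free e.
Proof.
split=> B /minor_drawing[d [q [c [d0]]]].
  exact: no_K5_drawing.
exact: no_K33_drawing.
Qed.

End Planarity.

(** * Counting *)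

Local Close Scope classical_set_scope.

Section Counting.
Variables (V : finType) (F : finFieldType).
Hypothesis F5 : #|F| = 5%N.

Lemma degree_le_prod (L : seq (V * V)) (k : V * V -> F) :
  degree_le (enum V) (size L)
    (fun c : {ffun V -> F} => \prod_(q <- L) (c q.2 - c q.1 - k q)).
Proof.
elim: L => [|q L IH] /=.
  apply: degree_le_ext (degree_le_const (enum V) 0 (1 : F)) => c.
  by rewrite big_nil.
set g := fun c : {ffun V -> F} => \prod_(q <- L) (c q.2 - c q.1 - k q) in IH.
have h v : degree_le (enum V) (size L).+1 (fun c => g c * c v).
  by apply: degree_le_mulX; rewrite ?mem_enum.
apply: (degree_le_ext (f := fun c => g c * c q.2 + (-1 * (g c * c q.1) + - k q * g c))).
  by move=> c; rewrite big_cons -/(g c); ring.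
apply: degree_le_add; first exact: h.
apply: degree_le_add; first by apply: degree_le_scale; apply: h.
by apply: degree_le_scale; apply: degree_le_mono IH.
Qed.

Lemma card_group_colorings (o : rel V) (phi : {set V} -> F) :
    group_colorings o phi != finset.set0 ->
  (5 ^ (4 * #|V|) <=
    5 ^ #|[set q : V * V | o q.1 q.2]%SET| * #|group_colorings o phi| ^ 4)%N.
Proof.
case/set0Pn => c0 c0P; set O := [set q : V * V | o q.1 q.2]%SET.
pose f (c : {ffun V -> F}) := \prod_(q <- enum O) (c q.2 - c q.1 - phi (edge q.1 q.2)).
have fP c : (f c != 0) = (c \in group_colorings o phi).
  rewrite prodf_seq_neq0 inE; apply/allP/forallP => [H u|H q].
    apply/forallP => w; apply/implyP => ouw.
    by have := H (u, w); rewrite mem_enum inE => /(_ ouw) /=; rewrite subr_eq0.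
  rewrite mem_enum inE => oq.
  by have /forallP/(_ q.2)/implyP/(_ oq) := H q.1; rewrite subr_eq0.
have := degree_le_card_nonroots F5 (enum_uniq V) (degree_le_prod (enum O) (fun q => phi (edge q.1 q.2))).
rewrite -cardE => /(_ _); rewrite (_ : [set c | _]%SET = group_colorings o phi).
  by apply; exists c0; rewrite fP.
by apply/setP => c; rewrite inE fP.
Qed.

End Counting.

(** * Colourability and edge count of an oriented graph *)

Section Orientation.
Variables (V : finType) (e o : rel V).
Hypotheses (e_simple : simple_graph e) (oP : orientation e o).

Lemma card_orientation : #|arcs e [set: V]%SET| = (#|[set q : V * V | o q.1 q.2]%SET|).*2.
Proof.
have cO : #|[set q : V * V | o q.1 q.2]%SET| = (\sum_u \sum_v (o u v : nat))%N.
  rewrite pair_bigA /= -sum1_card big_mkcond; apply: eq_bigr => q _.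
  by rewrite inE; case: (o _ _).
have cO' : #|[set q : V * V | o q.1 q.2]%SET| = (\sum_u \sum_v (o v u : nat))%N.
  by rewrite cO exchange_big.
rewrite card_arcs -addnn {1}cO cO' -big_split /=.
apply: eq_big => [u|u _]; first by rewrite inE.
rewrite -big_split /=; apply: eq_big => [v|v _]; first by rewrite inE.
by rewrite oP.1; have := oP.2 u v; case: (o u v); case: (o v u).
Qed.

Lemma group_colorable (Gamma : finZmodType) (phi : {set V} -> Gamma) :
  kuratowski_free e -> (5 <= #|Gamma|)%N -> group_colorings o phi != finset.set0.
Proof.
move=> e_free G5; have [e_sym e_irr] := e_simple.
(* At most one disjunct is active, since no edge is oriented both ways; cancellation in the group
   then makes the forbidden colour unique. *)
pose cf u v (a b : Gamma) :=
  o u v && (b - a == phi (edge u v)) || o v u && (a - b == phi (edge v u)).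
have [||c cP] := kuratowski_free_colorable e_sym e_irr e_free (cf := cf) _ _ G5.
- by move=> u v a b; rewrite /cf orbC.
- move=> u v a b b'; have := oP.2 u v; rewrite /cf.
  case: (o u v); case: (o v u) => //= _; rewrite ?orbF => /eqP<- /eqP.
    by move/addIr.
  by move/addrI/oppr_inj.
apply/set0Pn; exists [ffun v => c v]; rewrite inE.
apply/forallP => u; apply/forallP => w; apply/implyP => ouw; rewrite !ffunE.
have euw : e u w by rewrite oP.1 ouw.
by have := cP u w euw; rewrite /cf ouw negb_or => /andP[].
Qed.

Lemma card_kuratowski_free_orientation :
  kuratowski_free e -> (#|[set q : V * V | o q.1 q.2]%SET| <= 3 * #|V|)%N.
Proof.
move=> e_free; have [e_sym e_irr] := e_simple.
rewrite -leq_double -card_orientation -[X in (_ <= (3 * X).*2)%N]cardsT.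
have [V1|V2] := leqP #|[set: V]%SET| 1; first by rewrite card_arcs_le1.
have := kuratowski_free_arcs e_sym e_irr e_free (leqnn _) (connected_in0 e) _ V2.
rewrite disjoint_sym -setI_eq0 finset.set0I eqxx => /(_ isT).
clear; lia.
Qed.

End Orientation.

Lemma count_bound (V : finType) (e o : rel V) (phi : {set V} -> 'F_5) :
  simple_graph e -> orientation e o -> kuratowski_free e ->
  (2 ^ #|V| <= #|group_colorings o phi| ^ 9)%N.
Proof.
move=> e_simple oP e_free; have F5 : #|'F_5| = 5%N by rewrite card_Fp.
have ne := group_colorable e_simple oP phi e_free (eq_leq (esym F5)).
have := card_group_colorings F5 ne.
have := card_kuratowski_free_orientation e_simple oP e_free.
have N0 : (0 < #|group_colorings o phi|)%N by rewrite card_gt0.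
move: #|group_colorings _ _| N0 => N N0; set d := #|_| => dn key.
(* Of the exponent 4n at most 3n goes to the edges, leaving 5^n; this exceeds 2^n, and passing from
   [N ^ 4] to [N ^ 9] only needs [N] positive. *)
have N4 : (5 ^ #|V| <= N ^ 4)%N.
  rewrite -(leq_pmul2l (m := 5 ^ (3 * #|V|))) ?expn_gt0 // -expnD.
  rewrite (_ : 3 * #|V| + #|V| = 4 * #|V|)%N; last by clear; lia.
  apply: leq_trans key _; apply: leq_mul => //.
  by rewrite leq_exp2l.
have V25 : (2 ^ #|V| <= 5 ^ #|V|)%N by case: #|V| => // k; rewrite leq_exp2r.
by apply: leq_trans V25 (leq_trans N4 _); apply: leq_pexp2l.
Qed.

Unset Implicit Arguments.

Theorem theoremB (R : realType) (V : finType) (e : rel V)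
    (e_simple : simple_graph e) (e_planar : planar R e)
    (o : rel V) (o_orients : orientation e o) (phi : {set V} -> 'Z_5) :
  2 `^ (#|V|%:R / 9) <= #|group_colorings o phi|%:R :> R.
Proof.
case: e_planar => p [A pA].
have e_free := planar_kuratowski_free e_simple.1 e_simple.2 pA.
have key : (2 ^ #|V| <= #|group_colorings o phi| ^ 9)%N.
  (* ['F_5] computes to ['Z_5], so [phi] and its colourings can be read over the field. *)
  exact: (count_bound (phi : {set V} -> 'F_5) e_simple o_orients e_free).
have -> : #|group_colorings o phi|%:R = ((#|group_colorings o phi| ^ 9)%:R : R) `^ 9^-1.
  by rewrite natrX -powR_mulrn // -powRrM mulfV ?powRr1 // pnatr_eq0.
rewrite powRrM powR_mulrn // -natrX.
by apply: ge0_ler_powR; rewrite ?nnegrE ?invr_ge0 ?ler_nat.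
Qed.
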